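(* Let $R>0$ and $\beta\in RB_1^p=\{v\in\mathbb R^p:\|v\|_1\le R\}$. Let $Y=X\beta+\xi$, where the rows of $X\in\mathbb R^{N\times p}$ are independent, mean-zero, $L$-sub-Gaussian random vectors with covariance $\Sigma$ satisfying $\lambda_-I_p\preceq\Sigma\preceq\lambda_+I_p$ ($0<\lambda_-\le\lambda_+<\infty$), and $\xi=(\xi_1,\dots,\xi_N)$ has independent, mean-zero, sub-Gaussian entries with $\|\xi_i\|_{\psi_2}\le\sigma$ and is independent of $X$. Then the constrained Lasso $$\widehat\beta\in\operatorname*{argmin}_{\|\nu\|_1\le R}\frac1N\|Y-X\nu\|_2^2$$ satisfies $$\mathbb E\|\widehat\beta-\beta\|_2^2\le C\left\{\sigma R\sqrt{\frac{\log(ep)}{N}}+R^2\,\frac{\log(ep)}{N}\right\},$$ where $C$ depends only on $L,\lambda_-,\lambda_+$.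
   Context: For a real random variable $Z$, $\|Z\|_{\psi_2}=\inf\{a>0:\mathbb E\exp(Z^2/a^2)\le e\}$. A mean-zero random vector $X_i$ in $\mathbb R^p$ is $L$-sub-Gaussian if $\mathbb E\exp(\delta\langle v,X_i\rangle)\le\exp(\delta^2L^2/2)$ for all $\delta\in\mathbb R$ and all unit vectors $v\in\mathbb R^p$. *)

(* Defs.v *)
From HB Require Import structures.
From mathcomp Require Import all_boot all_order all_algebra.
From mathcomp Require Import all_classical all_reals all_analysis.
Set Implicit Arguments.
Unset Strict Implicit.
Unset Printing Implicit Defensive.
Import Order.TTheory GRing.Theory Num.Theory.
Import numFieldNormedType.Exports.
Local Open Scope classical_set_scope.
Local Open Scope ring_scope.

(* The library norm `|v| on matrices is the sup norm, so the l1 and l2 norms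
   on R^p are defined here. *)
Definition l1norm (R : realType) (p : nat) (v : 'cV[R]_p) : R :=
  \sum_(j < p) `|v j 0|.

Definition l2norm (R : realType) (p : nat) (v : 'cV[R]_p) : R :=
  Num.sqrt (\sum_(j < p) v j 0 ^+ 2).

Definition inner (R : realType) (p : nat) (u v : 'cV[R]_p) : R :=
  \sum_(j < p) u j 0 * v j 0.

Definition psdmx (R : realType) (p : nat) (M : 'M[R]_p) : Prop :=
  M^T = M /\ forall v : 'cV[R]_p, 0 <= inner v (M *m v).

Definition loewner_le (R : realType) (p : nat) (A B : 'M[R]_p) : Prop :=
  psdmx (B - A).

(* A random matrix is a map to 'M[R]_(m, n) with measurable entries; this is
   Borel measurability for the topology of R^(m * n).  Random vectors are the
   one-column (or one-row) case. *)
Definition random_mx d (T : measurableType d) (R : realType) (m n : nat)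
    (Z : T -> 'M[R]_(m, n)) : Prop :=
  forall i j, measurable_fun setT (fun w => Z w i j).

(* The sigma-algebra on T generated by the entries of Z. *)
Definition sigma_mx d (T : measurableType d) (R : realType) (m n : nat)
    (Z : T -> 'M[R]_(m, n)) : set (set T) :=
  <<s \bigcup_(ij in [set: 'I_m * 'I_n])
        preimage_set_system setT (fun w => Z w ij.1 ij.2) measurable >>.

Definition mutually_independent d (T : measurableType d) (R : realType)
    (P : probability T R) (I : finType) (F : I -> set (set T)) : Prop :=
  forall (J : {set I}) (A : I -> set T), (forall i, i \in J -> F i (A i)) ->
    P (\bigcap_(i in [set` J]) A i) = (\prod_(i in J) P (A i))%E.

Definition independent2 d (T : measurableType d) (R : realType)
    (P : probability T R) (F G : set (set T)) : Prop :=
  forall A B, F A -> G B -> P (A `&` B) = (P A * P B)%E.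

(* The rows of Z are mutually independent random vectors. *)
Definition independent_rows d (T : measurableType d) (R : realType)
    (P : probability T R) (m n : nat) (Z : T -> 'M[R]_(m, n)) : Prop :=
  mutually_independent P (fun i : 'I_m => sigma_mx (fun w => row i (Z w))).

Definition mean_zero d (T : measurableType d) (R : realType)
    (P : probability T R) (Z : T -> R) : Prop :=
  P.-integrable setT (EFin \o Z) /\ 'E_P[Z]%E = 0%E.

Definition mean_zero_vec d (T : measurableType d) (R : realType)
    (P : probability T R) (p : nat) (Z : T -> 'cV[R]_p) : Prop :=
  forall j, mean_zero P (fun w => Z w j 0).

Definition covariance_mx d (T : measurableType d) (R : realType)
    (P : probability T R) (p : nat) (Z : T -> 'cV[R]_p) (S : 'M[R]_p) : Prop :=
  forall j k, covariance P (fun w => Z w j 0) (fun w => Z w k 0) = (S j k)%:E.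

Definition subgaussian_vec d (T : measurableType d) (R : realType)
    (P : probability T R) (p : nat) (L : R) (Z : T -> 'cV[R]_p) : Prop :=
  forall (delta : R) (v : 'cV[R]_p), l2norm v = 1 ->
    ('E_P[fun w => expR (delta * inner v (Z w))]
       <= (expR (delta ^+ 2 * L ^+ 2 / 2))%:E)%E.

(* The infimum is taken in the extended reals, so that the norm is +oo when no
   a > 0 is admissible. *)
Definition psi2_norm d (T : measurableType d) (R : realType)
    (P : probability T R) (Z : T -> R) : \bar R :=
  ereal_inf [set a%:E | a in [set a : R | 0 < a /\
    ('E_P[fun w => expR (Z w ^+ 2 / a ^+ 2)] <= (expR 1)%:E)%E]].

Definition lasso_loss (R : realType) (N p : nat)
    (X : 'M[R]_(N, p)) (Y : 'cV[R]_N) (nu : 'cV[R]_p) : R :=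
  N%:R^-1 * l2norm (Y - X *m nu) ^+ 2.

Definition lasso_argmin (R : realType) (N p : nat) (r : R)
    (X : 'M[R]_(N, p)) (Y : 'cV[R]_N) : set 'cV[R]_p :=
  [set b | l1norm b <= r /\
    forall nu, l1norm nu <= r -> lasso_loss X Y b <= lasso_loss X Y nu].

(* Main.v *)
Require Import Defs.
From HB Require Import structures.
From mathcomp Require Import all_boot all_order all_algebra.
From mathcomp Require Import all_classical all_reals all_analysis.
From mathcomp Require Import measurable_realfun simple_functions ring lra.
Set Implicit Arguments.
Unset Strict Implicit.
Unset Printing Implicit Defensive.
Import Order.TTheory GRing.Theory Num.Theory.
Import numFieldNormedType.Exports.
Import HBNNSimple.
Local Open Scope classical_set_scope.
Local Open Scope ring_scope.

(** The error v = betahat - beta has l1 norm at most 2r, so |v|_2^2 <= 4r^2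
    always, and failure events of probability O(log(ep)/N) cost nothing.  By
    optimality |Xv|_2^2 <= 2 <xi, Xv> <= 4r max_j |<X_j, xi>|, and this maximum
    is O(sigma L sqrt(N log(ep))) in expectation by a union bound on exponential
    moments, computed conditionally on X.

    It remains to bound |Xv|_2^2 / N from below by c |v|_2^2 - C r^2 log(ep)/N.
    For one fixed vector u, Laplace's method gives |Xu|_2^2 >= N c |u|_2^2
    outside an event of probability exp(-c1 N).  A union bound extends this to
    the (2p)^(k+1) sums of k+1 signed basis vectors, k ~ N/log(ep), and Maurey's
    empirical method transfers it to the whole l1 ball at the price of r^2/k.
    All failure indicators are dominated by sums of exponentials, so only
    expectations are ever computed. *)

(** * Measurability and independence *)

(** The sparsity level comes from a budget. With l = log(ep), the union bound costs exp((k+1) l) and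
    the estimate for one vector gains exp(-c1 N), so k is the largest integer with k l <= c1 N / 4.
    If no such k >= 1 exists, l / N is bounded below and the diameter bound already has the claimed
    order. Maurey's method, applied to the indefinite form |Xv|_2^2 - c N |v|_2^2, needs an upper
    bound on its diagonal; hence a second kind of failure, a column of X with squared norm above 10
    L^2 N.

    A sum F of exponentials enters only through an alternative: if F < 1, every exponent is negative
    and the good case holds; if F >= 1, the diameter bound times F suffices. The error bound is thus
    affine in random sums of exponentials, and the maximal noise correlation is linearized in the
    same spirit by y <= b + exp(y - b). The noise scale is some a > sigma, sent to sigma at the very
    end, because the infimum defining the psi_2 norm need not be attained. *)

Definition measurable_wrt d (T : measurableType d) d' (U : measurableType d')
    (F : set (set T)) (f : T -> U) : Prop :=
  @measurable_fun _ _ (g_sigma_algebraType F) U setT f.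

Lemma measurable_wrt_fun d (T : measurableType d) d' (U : measurableType d')
    (F : set (set T)) (f : T -> U) : F `<=` measurable ->
  measurable_wrt F f -> measurable_fun setT f.
Proof.
move=> FT mf _ B mB; have := mf measurableT B mB.
by apply: smallest_sub => //; exact: sigma_algebra_measurable.
Qed.

(** The hypothesis is the case of indicators. The simple approximants of [g] are built in the
    generated sigma-algebra, not the ambient one, so their level sets lie in [<<s F >>] and the
    hypothesis applies to each; monotone convergence on both sides concludes. *)
Lemma ge0_integral_wrt_mul d (T : measurableType d) (R : realType)
    (P : probability T R) (F : set (set T)) (G g : T -> R) (c : R) :
  F `<=` measurable ->
  measurable_fun setT G -> (forall x, 0 <= G x) ->
  measurable_wrt F g -> (forall x, 0 <= g x) ->
  (forall A, <<s F >> A ->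
    (\int[P]_x (G x * \1_A x)%:E = c%:E * P A)%E) ->
  (\int[P]_x (G x * g x)%:E = c%:E * \int[P]_x (g x)%:E)%E.
Proof.
move=> FT mG G0 mg g0 H.
have mg' : @measurable_fun _ _ (g_sigma_algebraType F) (\bar R) setT (EFin \o g).
  exact/measurable_EFinP.
pose f_ := nnsfun_approx measurableT mg'.
have mf n : measurable_fun setT (f_ n : T -> R).
  by apply: (measurable_wrt_fun FT); exact: measurable_funP.
have mFA r n : <<s F >> (f_ n @^-1` [set r]).
  have := @measurable_funP _ _ _ _ setT (f_ n) measurableT [set r] (measurable_set1 r).
  by rewrite setTI.
have mTA r n : measurable (f_ n @^-1` [set r] : set T).
  by move: (mFA r n); apply: smallest_sub => //; exact: sigma_algebra_measurable.
have cvgf x : EFin \o f_^~ x @ \oo --> (g x)%:E.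
  by apply: (cvg_nnsfun_approx measurableT mg') => // y _; rewrite lee_fin.
have ndf x m n : (m <= n)%N -> f_ m x <= f_ n x.
  by move=> mn; exact/lefP/(nd_nnsfun_approx measurableT mg').
have f0 n x : 0 <= f_ n x by [].
have step n : (\int[P]_x (G x * f_ n x)%:E = c%:E * \int[P]_x (f_ n x)%:E)%E.
  have muli0 r x : 0 <= r * \1_(f_ n @^-1` [set r]) x.
    by have := nnfun_muleindic_ge0 (f_ n) r x; rewrite -EFinM lee_fin.
  have mi r : measurable_fun setT (\1_(f_ n @^-1` [set r]) : T -> R).
    exact: measurable_indic.
  transitivity (\int[P]_x \sum_(r \in range (f_ n))
      (G x * (r * \1_(f_ n @^-1` [set r]) x))%:E)%E.
    by apply: eq_integral => x _; rewrite fsumEFin// -mulr_fsumr -fimfunE.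
  rewrite ge0_integral_fsum//; last 2 first.
  - by move=> r; apply/measurable_EFinP/measurable_funM => //; exact: measurable_funM.
  - by move=> r x _; rewrite lee_fin mulr_ge0.
  under [in RHS]eq_integral => x _ do rewrite fimfunE -fsumEFin//.
  rewrite ge0_integral_fsum//; last 2 first.
  - by move=> r; apply/measurable_EFinP/measurable_funM.
  - by move=> r x _; rewrite lee_fin.
  rewrite ge0_mule_fsumr; last first.
    by move=> r; apply: integral_ge0 => x _; rewrite lee_fin.
  apply: eq_fsbigr => r; rewrite inE => -[t _ <-].
  set k := f_ n t; set A := f_ n @^-1` [set k].
  under eq_integral => x _ do rewrite mulrCA EFinM.
  rewrite ge0_integralZl//; last 3 first.
  - by apply/measurable_EFinP/measurable_funM => //; exact: mi.
  - by move=> x _; rewrite lee_fin mulr_ge0.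
  - by rewrite lee_fin.
  rewrite (H A (mFA _ _)) muleCA; congr (_ * _)%E.
  under [RHS]eq_integral => x _ do rewrite EFinM.
  rewrite ge0_integralZl//; last 2 first.
  - by apply/measurable_EFinP; exact: mi.
  - by rewrite lee_fin.
  by rewrite (integral_indic P measurableT (mTA _ _)) setIT.
have cG : (\int[P]_x (G x * f_ n x)%:E)%E @[n --> \oo] -->
    (\int[P]_x (G x * g x)%:E)%E.
  rewrite [X in _ --> X](_ : _ =
      (\int[P]_x limn (fun n => (G x * f_ n x)%:E))%E); last first.
    apply: eq_integral => x _; apply/esym/cvg_lim => //.
    under eq_fun do rewrite EFinM.
    by rewrite EFinM; apply: cvgeZl => //; exact: cvgf.
  apply: cvg_monotone_convergence => //.
  - by move=> n; apply/measurable_EFinP/measurable_funM.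
  - by move=> n x _; rewrite lee_fin mulr_ge0.
  - by move=> x _ m n mn; rewrite lee_fin ler_wpM2l// ndf.
have cg : (\int[P]_x (f_ n x)%:E)%E @[n --> \oo] --> (\int[P]_x (g x)%:E)%E.
  rewrite [X in _ --> X](_ : _ = (\int[P]_x limn (fun n => (f_ n x)%:E))%E).
    apply: cvg_monotone_convergence => //.
    - by move=> n; apply/measurable_EFinP.
    - by move=> n x _; rewrite lee_fin.
    - by move=> x _ m n mn; rewrite lee_fin ndf.
  by apply: eq_integral => x _; apply/esym/cvg_lim => //; exact: cvgf.
rewrite (funext step) in cG.
by apply: (cvg_unique _ cG) => //; exact: cvgeZl.
Qed.

(* Indicators of independent events are replaced by nonnegative functions one
   index at a time. *)
Lemma integral_prod_mutually_independent d (T : measurableType d)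
    (R : realType) (P : probability T R) (n : nat) (F : 'I_n -> set (set T))
    (g : 'I_n -> T -> R) (e : 'I_n -> R) :
  (forall i, F i `<=` measurable) ->
  mutually_independent P (fun i => <<s F i >>) ->
  (forall i, measurable_wrt (F i) (g i)) -> (forall i x, 0 <= g i x) ->
  (forall i, (\int[P]_x (g i x)%:E = (e i)%:E)%E) ->
  (\int[P]_x (\prod_(i < n) g i x)%:E = (\prod_(i < n) e i)%:E)%E.
Proof.
move=> FT ind mg g0 ge.
have mFT i A : <<s F i >> A -> measurable A.
  by apply: smallest_sub => //; exact: sigma_algebra_measurable.
(* Hybrid products: the first [k] factors are functions, the others indicators. The events [A] are
   quantified inside the induction because the step from [k] to [k.+1] tests the remaining factors
   against every event of index [k]. *)
pose h (k : nat) (A : 'I_n -> set T) (i : 'I_n) : T -> R :=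
  if (i < k)%N then g i else \1_(A i).
have h0 k A i x : 0 <= h k A i x by rewrite /h; case: ifP.
have mh k A i : measurable (A i) -> measurable_fun setT (h k A i).
  move=> mA; rewrite /h; case: ifP => _; last exact: measurable_indic.
  exact: measurable_wrt_fun (mg i).
suff H k : (k <= n)%N -> forall A : 'I_n -> set T, (forall i, <<s F i >> (A i)) ->
    (\int[P]_x (\prod_(i < n) h k A i x)%:E =
      (\prod_(i < n) (if (i < k)%N then e i else fine (P (A i))))%:E)%E.
  have := H n (leqnn _) (fun=> setT).
  under eq_integral => x _ do under eq_bigr => i _ do rewrite /h ltn_ord.
  under [in RHS]eq_bigr => i _ do rewrite ltn_ord.
  by apply => i; exact: (@measurableT _ (g_sigma_algebraType (F i))).
elim: k => [_ A FA|k IH kn A FA].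
  transitivity (\int[P]_x (\1_(\bigcap_(i in [set: 'I_n]) A i) x)%:E)%E.
    apply: eq_integral => x _; congr EFin; rewrite /h/=.
    rewrite indicE; case: (pselect ((\bigcap_(i in [set: 'I_n]) A i) x)) => Ax.
      rewrite mem_set// big1// => i _; rewrite indicE mem_set//; exact: Ax.
    rewrite memNset//.
    have [i Ai] : exists i, ~ A i x by apply/existsNP => H; apply: Ax => i _.
    by rewrite (bigD1 i)//= indicE memNset// mul0r.
  rewrite integral_indic//; last first.
    by apply: fin_bigcap_measurable => // i _; exact: mFT (FA i).
  rewrite setIT.
  have := ind [set: 'I_n]%SET A (fun i _ => FA i).
  rewrite (_ : [set` [set: 'I_n]%SET] = [set: 'I_n]); last first.
    by apply/seteqP; split => i //= _; rewrite inE.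
  move=> H; apply: (etrans H); rewrite -prodEFin big_mkcond/=; apply: eq_bigr => i _.
  by rewrite inE fineK// fin_num_measure//; exact: mFT (FA i).
pose k' := Ordinal kn.
pose G x := \prod_(i | i != k') h k A i x.
have hG i : i != k' -> h k.+1 A i = h k A i.
  rewrite /h ltnS leq_eqVlt => /negbTE ik; case: eqP => // ik'.
  by move: ik; rewrite -val_eqE/= ik' eqxx.
pose c := \prod_(i | i != k') (if (i < k)%N then e i else fine (P (A i))).
transitivity (\int[P]_x (G x * g k' x)%:E)%E.
  apply: eq_integral => x _; rewrite (bigD1 k')//= mulrC; congr (_ * _)%:E.
    by apply: eq_bigr => i ik; rewrite hG.
  by rewrite /h ltnS leqnn.
rewrite (@ge0_integral_wrt_mul _ _ _ _ (F k') G (g k') c)//.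
- rewrite ge -EFinM [in RHS](bigD1 k')//= ltnS leqnn mulrC; congr (_ * _)%:E.
  apply: eq_bigr => i /negbTE ik; rewrite ltnS [in RHS]leq_eqVlt; case: eqP => // ik'.
  by move: ik; rewrite -val_eqE/= ik' eqxx.
- rewrite /G; under eq_fun => x do rewrite -big_filter.
  by apply: measurable_prod => i _; apply: mh; exact: mFT (FA i).
- by move=> x; apply: prodr_ge0 => i _; exact: h0.
- move=> B FB.
  pose A' i := if i == k' then B else A i.
  have FA' i : <<s F i >> (A' i) by rewrite /A'; case: eqP => [->|].
  have := IH (ltnW kn) A' FA'.
  rewrite (bigD1 k')//= ltnn /A' eqxx EFinM fineK ?fin_num_measure//; last first.
    exact: mFT FB.
  rewrite muleC (eq_bigr (fun i : 'I_n =>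
    if (i < k)%N then e i else fine (P (A i)))); last first.
    by move=> i /negbTE ->.
  rewrite -/c => <-; apply: eq_integral => x _; rewrite (bigD1 k')//= mulrC.
  congr (_ * _)%:E; first by rewrite /h ltnn eqxx.
  by apply: eq_bigr => i /negbTE ik; rewrite /h ik.
Qed.

(** Independence says that the law of the diagonal map x |-> (x, x), on T * T with the product of
    the two generated sigma-algebras, agrees with the product of the marginal laws on rectangles,
    hence everywhere; Tonelli does the rest. The identity maps [idF] and [idG] only coarsen the
    sigma-algebra of [T]. *)
Lemma ge0_integral_independent2 d (T : measurableType d) (R : realType)
    (P : probability T R) (F G : set (set T)) (h : T * T -> R) :
  F `<=` measurable -> G `<=` measurable ->
  independent2 P <<s F >> <<s G >> ->
  @measurable_fun _ _ (g_sigma_algebraType F * g_sigma_algebraType G)%type R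
    setT h ->
  (forall x, 0 <= h x) ->
  (\int[P]_x (h (x, x))%:E = \int[P]_x \int[P]_y (h (x, y))%:E)%E.
Proof.
move=> FT GT ind mh h0.
have mid (H : set (set T)) : H `<=` measurable ->
    @measurable_fun _ _ T (g_sigma_algebraType H) setT idfun.
  move=> HT _ A HA; rewrite setTI.
  by move: HA; apply: smallest_sub => //; exact: sigma_algebra_measurable.
have mdiag : @measurable_fun _ _ T
    (g_sigma_algebraType F * g_sigma_algebraType G)%type setT (fun x => (x, x)).
  by apply/measurable_fun_pairP; split; exact: mid.
pose mF := isMeasurableFun.Build _ _ _ _ _ (mid F FT).
pose mG := isMeasurableFun.Build _ _ _ _ _ (mid G GT).
pose mD := isMeasurableFun.Build _ _ _ _ _ mdiag.
pose idF : {mfun T >-> g_sigma_algebraType F} := HB.pack (idfun : T -> T) mF.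
pose idG : {mfun T >-> g_sigma_algebraType G} := HB.pack (idfun : T -> T) mG.
pose diag : {mfun T >-> (g_sigma_algebraType F * g_sigma_algebraType G)%type} :=
  HB.pack (fun x : T => (x, x)) mD.
have mh' : measurable_fun setT
    (fun z : g_sigma_algebraType F * g_sigma_algebraType G => (h z)%:E).
  exact/measurable_EFinP.
transitivity (\int[distribution P diag]_z (h z)%:E)%E.
  by rewrite ge0_integral_distribution// => z; rewrite lee_fin.
transitivity (\int[distribution P idF \x distribution P idG]_z (h z)%:E)%E.
  apply: eq_measure_integral => A mA _; apply/esym.
  by apply: product_measure_unique.
rewrite fubini_tonelli1//.
rewrite ge0_integral_distribution//; last 2 first.
- exact: measurable_fun_fubini_tonelli_F.
- by move=> x; apply: integral_ge0 => y _; rewrite lee_fin.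
apply: eq_integral => x _ /=.
rewrite /fubini_F ge0_integral_distribution//.
- by apply: measurableT_comp mh' _; exact: measurable_pair1.
- by move=> y; rewrite lee_fin.
Qed.

(** * Integrals of nonnegative real functions and moment bounds *)

Lemma ge0_le_integral_EFin d (T : measurableType d) (R : realType)
    (mu : {measure set T -> \bar R}) (f g : T -> R) :
  measurable_fun setT f -> measurable_fun setT g ->
  (forall x, 0 <= f x) -> (forall x, f x <= g x) ->
  (\int[mu]_x (f x)%:E <= \int[mu]_x (g x)%:E)%E.
Proof.
move=> mf mg f0 fg; apply: ge0_le_integral => //.
- by move=> x _; rewrite lee_fin.
- exact/measurable_EFinP.
- exact/measurable_EFinP.
- by move=> x _; rewrite lee_fin.
Qed.

Lemma ge0_integralZl_EFin_fun d (T : measurableType d) (R : realType)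
    (mu : {measure set T -> \bar R}) (f : T -> R) (k : R) :
  measurable_fun setT f -> (forall x, 0 <= f x) -> 0 <= k ->
  (\int[mu]_x (k * f x)%:E = k%:E * \int[mu]_x (f x)%:E)%E.
Proof.
move=> mf f0 k0; under eq_integral => x _ do rewrite EFinM.
apply: ge0_integralZl => //; first exact/measurable_EFinP.
by move=> x _; rewrite lee_fin.
Qed.

Lemma ge0_integralD_EFin d (T : measurableType d) (R : realType)
    (mu : {measure set T -> \bar R}) (f g : T -> R) :
  measurable_fun setT f -> measurable_fun setT g ->
  (forall x, 0 <= f x) -> (forall x, 0 <= g x) ->
  (\int[mu]_x (f x + g x)%:E =
   \int[mu]_x (f x)%:E + \int[mu]_x (g x)%:E)%E.
Proof.
move=> mf mg f0 g0; under eq_integral => x _ do rewrite EFinD.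
apply: ge0_integralD => //.
- by move=> x _; rewrite lee_fin.
- exact/measurable_EFinP.
- by move=> x _; rewrite lee_fin.
- exact/measurable_EFinP.
Qed.

Lemma ge0_integral_sum_EFin d (T : measurableType d) (R : realType)
    (mu : {measure set T -> \bar R}) (I : Type) (s : seq I) (Q : pred I)
    (f : I -> T -> R) :
  (forall i, measurable_fun setT (f i)) -> (forall i x, 0 <= f i x) ->
  (\int[mu]_x (\sum_(i <- s | Q i) f i x)%:E =
   \sum_(i <- s | Q i) \int[mu]_x (f i x)%:E)%E.
Proof.
move=> mf f0.
under eq_integral => x _ do rewrite -sumEFin -big_filter.
rewrite ge0_integral_sum ?big_filter//.
- by move=> i; exact/measurable_EFinP.
- by move=> i x _; rewrite lee_fin.
Qed.

Lemma integral_cst_EFin d (T : measurableType d) (R : realType)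
    (P : probability T R) (k : R) : (\int[P]_x k%:E = k%:E)%E.
Proof. by rewrite integral_cst//= probability_setT mule1. Qed.

(** * Exponential moments of Gaussian, sub-Gaussian and psi_2-bounded variables *)

Lemma normal_pdf_shift (R : realType) (x g : R) :
  expR (x ^+ 2 / 2) * normal_pdf x 1 g = expR (x * g) * normal_pdf 0 1 g.
Proof.
rewrite !normal_pdfE ?oner_eq0// /normal_fun mulrCA [RHS]mulrCA -!expRD.
by congr (_ * expR _); rewrite !expr1n subr0; field.
Qed.

Lemma normal_pdf_mgf (R : realType) (x : R) :
  (\int[@lebesgue_measure R]_g (expR (x * g) * normal_pdf 0 1 g)%:E =
   (expR (x ^+ 2 / 2))%:E)%E.
Proof.
under eq_integral => g _ do rewrite -normal_pdf_shift.
rewrite ge0_integralZl_EFin_fun ?expR_ge0 ?integral_normal_pdf ?mule1//.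
- exact: measurable_normal_pdf.
- exact: normal_pdf_ge0.
Qed.

(** The weighted density is [tau] times a normal density of variance 1 / (1 - 2y), so the integral
    equals [tau]. The range y <= 1/4 is what 1 / (1 - 2y) <= 1 + 4y requires. *)
Lemma normal_pdf_sqr_mgf (R : realType) (y : R) : 0 <= y -> y <= 1 / 4 ->
  (\int[@lebesgue_measure R]_g (expR (y * g ^+ 2) * normal_pdf 0 1 g)%:E <=
   (expR (2 * y))%:E)%E.
Proof.
move=> y0 y4.
pose v := (1 - 2 * y)^-1; pose tau := Num.sqrt v.
have w0 : 0 < 1 - 2 * y by lra.
have v0 : 0 < v by rewrite invr_gt0.
have tau0 : 0 < tau by rewrite sqrtr_gt0.
have tau2 : tau ^+ 2 = v by rewrite sqr_sqrtr// ltW.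
have peak : normal_peak (1 : R) = tau * normal_peak tau.
  rewrite /normal_peak expr1n mul1r tau2 -[v * pi *+ 2]mulrnAr.
  by rewrite sqrtrM ?(ltW v0)// -/tau invfM mulrA divff ?mul1r// gt_eqF.
have E g : expR (y * g ^+ 2) * normal_pdf 0 1 g = tau * normal_pdf 0 tau g.
  rewrite !normal_pdfE ?oner_eq0 ?gt_eqF// peak /normal_fun mulrCA -mulrA.
  congr (_ * (_ * _)); rewrite -expRD; congr expR.
  by rewrite expr1n tau2 subr0 /v; field; rewrite gt_eqF.
under eq_integral => g _ do rewrite E.
rewrite ge0_integralZl_EFin_fun ?(ltW tau0)//; last 2 first.
- exact: measurable_normal_pdf.
- exact: normal_pdf_ge0.
rewrite integral_normal_pdf mule1 lee_fin.
rewrite -(@ler_pXn2r _ 2) ?nnegrE ?expR_ge0 ?(ltW tau0)// tau2 -expRM_natl.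
apply: (le_trans _ (expR_ge1Dx _)); rewrite /v -[leLHS]mul1r ler_pdivrMr//.
by nra.
Qed.

(** Gaussian linearization: exp(s Z^2) is the mean of exp(sqrt(2s) Z g) over a standard normal g.
    After exchanging the integrals, the hypothesis at delta = sqrt(2s) g leaves the Gaussian mean of
    exp(s L^2 g^2). *)
Lemma subgaussian_sqr_mgf d (T : measurableType d) (R : realType)
    (P : probability T R) (Z : T -> R) (L s : R) :
  measurable_fun setT Z ->
  (forall delta : R, (\int[P]_w (expR (delta * Z w))%:E
     <= (expR (delta ^+ 2 * L ^+ 2 / 2))%:E)%E) ->
  0 <= s -> s * L ^+ 2 <= 1 / 4 ->
  (\int[P]_w (expR (s * Z w ^+ 2))%:E <= (expR (2 * (s * L ^+ 2)))%:E)%E.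
Proof.
move=> mZ sg s0 sL.
pose a := Num.sqrt (2 * s).
have a2 : a ^+ 2 = 2 * s by rewrite sqr_sqrtr// mulr_ge0.
have E w : (expR (s * Z w ^+ 2))%:E =
    (\int[@lebesgue_measure R]_g (expR (a * Z w * g) * normal_pdf 0 1 g)%:E)%E.
  by rewrite normal_pdf_mgf exprMn a2; congr (expR _)%:E; lra.
under eq_integral => w _ do rewrite E.
pose f (z : T * measurableTypeR R) : \bar R :=
  (expR (a * Z z.1 * z.2) * normal_pdf 0 1 z.2)%:E.
have mf : measurable_fun setT f.
  apply/measurable_EFinP/measurable_funM.
    apply: measurableT_comp => //; apply: measurable_funM => //.
    by apply: measurable_funM => //; exact: measurableT_comp.
  by apply: (measurableT_comp (measurable_normal_pdf 0 1)).
have f0 z : (0 <= f z)%E.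
  by rewrite lee_fin mulr_ge0// ?expR_ge0 ?normal_pdf_ge0.
rewrite (fubini_tonelli (m2 := @lebesgue_measure R) f)//.
apply: le_trans (normal_pdf_sqr_mgf _ sL); last by rewrite mulr_ge0// sqr_ge0.
apply: ge0_le_integral => //.
- by move=> g _; exact: integral_ge0.
- exact: (measurable_fun_fubini_tonelli_G f).
- apply/measurable_EFinP/measurable_funM; last exact: measurable_normal_pdf.
  by apply: measurableT_comp => //; exact: measurable_funM.
move=> g _; rewrite /f/=.
under eq_integral => w _ do rewrite mulrC.
rewrite ge0_integralZl_EFin_fun ?normal_pdf_ge0//; last first.
  by apply: measurableT_comp => //; do 2 apply: measurable_funM => //.
rewrite mulrC EFinM lee_wpmul2l ?lee_fin ?normal_pdf_ge0//.
have := sg (a * g); rewrite exprMn a2.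
rewrite (_ : 2 * s * g ^+ 2 * L ^+ 2 / 2 = s * L ^+ 2 * g ^+ 2); last by lra.
by under eq_integral => w _ do rewrite mulrAC.
Qed.

Lemma expR1_le3 (R : realType) : expR 1 <= 3 :> R.
Proof.
have h : 5 / 6 <= expR (- (1 / 6)) :> R by apply: le_trans (expR_ge1Dx _); lra.
(* Six factors suffice, since (6/5)^6 < 3. *)
rewrite (_ : 1 = 6%:R * (1 / 6)); last by lra.
rewrite expRM_natl.
have {}h : expR (1 / 6) <= 6 / 5 :> R.
  have := expR_gt0 (1 / 6 : R); move: h; rewrite expRN.
  move=> h e0; rewrite -(invrK (expR _)) -(invrK (6 / 5)).
  by rewrite lef_pV2 ?posrE ?invr_gt0//; lra.
apply: (@le_trans _ _ ((6 / 5) ^+ 6)); last by lra.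
by apply: lerXn2r; rewrite ?nnegrE ?expR_ge0.
Qed.

Lemma expR_half_le2 (R : realType) : expR (1 / 2) <= 2 :> R.
Proof.
have h : 2^-1 <= expR (- (1 / 2)) :> R by apply: le_trans (expR_ge1Dx _); lra.
by move: h; rewrite expRN lef_pV2 ?posrE ?expR_gt0.
Qed.

(** Integrate exp(-x) <= 1 - x + x^2 at x = t Z^2. The quadratic term is controlled by Z^4 <= 2 s^-2
    exp(s Z^2) with s = 1 / (4 L^2), where the exponential has mean at most exp(1/2) <= 2; this
    gives the 64 L^4 t^2. *)
Lemma subgaussian_lower_mgf d (T : measurableType d) (R : realType)
    (P : probability T R) (Z : T -> R) (L lam t : R) :
  measurable_fun setT Z ->
  (forall delta : R, (\int[P]_w (expR (delta * Z w))%:E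
     <= (expR (delta ^+ 2 * L ^+ 2 / 2))%:E)%E) ->
  (lam%:E <= \int[P]_w (Z w ^+ 2)%:E)%E ->
  0 < L -> 0 <= t ->
  (\int[P]_w (expR (- (t * Z w ^+ 2)))%:E <=
    (expR (64 * L ^+ 4 * t ^+ 2 - t * lam))%:E)%E.
Proof.
move=> mZ sg lamZ L0 t0.
pose s := (4 * L ^+ 2)^-1.
have L20 : 0 < L ^+ 2 by rewrite exprn_gt0.
have s0 : 0 < s by rewrite invr_gt0 mulr_gt0.
have sL : s * L ^+ 2 = 1 / 4 by rewrite /s; field; rewrite gt_eqF.
have mZ2 : measurable_fun setT (fun w => Z w ^+ 2) by exact: measurable_funX.
have me k : measurable_fun setT (fun w => expR (k * Z w ^+ 2)).
  by apply: measurableT_comp => //; exact: measurable_funM.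
have sL' : s * L ^+ 2 <= 1 / 4 by rewrite sL.
have Es := subgaussian_sqr_mgf mZ sg (ltW s0) sL'.
rewrite sL in Es.
have ptw w : expR (- t * Z w ^+ 2) + t * Z w ^+ 2 <=
    1 + 2 * t ^+ 2 / s ^+ 2 * expR (s * Z w ^+ 2).
  set y := Z w ^+ 2; have y0 : 0 <= y by exact: sqr_ge0.
  have ty0 : 0 <= t * y by rewrite mulr_ge0.
  (* For x >= 0, (1 - x + x^2)(1 + x) = 1 + x^3 >= 1, and 1 + x <= exp x. *)
  have h1 : expR (- t * y) <= 1 - t * y + (t * y) ^+ 2.
    rewrite mulNr expRN -[leLHS]mul1r ler_pdivrMr ?expR_gt0//.
    apply: (@le_trans _ _ ((1 - t * y + (t * y) ^+ 2) * (1 + t * y))).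
      have : 0 <= (t * y) ^+ 3 by rewrite exprn_ge0.
      by move: (t * y) => z; lra.
    rewrite ler_wpM2l ?expR_ge1Dx//.
    by have := sqr_ge0 (t * y - 1 / 2); move: (t * y) => z; lra.
  have h2 : s ^+ 2 * y ^+ 2 / 2 <= expR (s * y).
    have := @expR_ge1Dxn _ (s * y) 1 (mulr_ge0 (ltW s0) y0).
    by rewrite exprMn (_ : (2`!)%:R = 2 :> R)//; lra.
  have h3 : t ^+ 2 * y ^+ 2 <= 2 * t ^+ 2 / s ^+ 2 * expR (s * y).
    rewrite [leRHS](_ : _ = t ^+ 2 * (expR (s * y) * 2 / s ^+ 2)); last first.
      by field; rewrite gt_eqF.
    rewrite ler_wpM2l ?sqr_ge0// ler_pdivlMr ?exprn_gt0//.
    by move: h2; lra.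
  by move: h1 h3; rewrite exprMn; lra.
have k0 : 0 <= 2 * t ^+ 2 / s ^+ 2.
  by rewrite mulr_ge0// ?invr_ge0 ?sqr_ge0 ?mulr_ge0 ?sqr_ge0.
have z0 w : 0 <= Z w ^+ 2 by exact: sqr_ge0.
have e0 k w : 0 <= expR (k * Z w ^+ 2) by exact: expR_ge0.
have tz0 w : 0 <= t * Z w ^+ 2 by exact: mulr_ge0.
have ke0 w : 0 <= 2 * t ^+ 2 / s ^+ 2 * expR (s * Z w ^+ 2) by exact: mulr_ge0.
have mtz : measurable_fun setT (fun w => t * Z w ^+ 2) by exact: measurable_funM.
have mke : measurable_fun setT
  (fun w => 2 * t ^+ 2 / s ^+ 2 * expR (s * Z w ^+ 2)) by exact: measurable_funM.
(* The linear term is kept on the left, so that only nonnegative functions are integrated. *)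
have I0 : (\int[P]_w (expR (- t * Z w ^+ 2))%:E + t%:E * \int[P]_w (Z w ^+ 2)%:E
    <= (1 + 2 * t ^+ 2 / s ^+ 2 * 2)%:E)%E.
  rewrite -ge0_integralZl_EFin_fun// -ge0_integralD_EFin//.
  apply: le_trans (ge0_le_integral_EFin _ _ _ _ ptw) _.
  - exact: measurable_funD.
  - exact: measurable_funD.
  - by move=> w; exact: addr_ge0.
  rewrite ge0_integralD_EFin// integral_cst_EFin ge0_integralZl_EFin_fun//.
  rewrite EFinD leeD2l// [leRHS]EFinM lee_wpmul2l ?lee_fin//.
  apply: le_trans Es _; rewrite lee_fin (_ : 2 * (1 / 4) = 1 / 2); last by lra.
  exact: expR_half_le2.
under eq_integral => w _ do rewrite -mulNr.
have tl : ((t * lam)%:E <= t%:E * \int[P]_w (Z w ^+ 2)%:E)%E.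
  by rewrite EFinM lee_wpmul2l ?lee_fin.
have : (\int[P]_w (expR (- t * Z w ^+ 2))%:E + (t * lam)%:E
    <= (1 + 2 * t ^+ 2 / s ^+ 2 * 2)%:E)%E.
  by apply: le_trans I0; rewrite leeD2l.
rewrite -leeBrDr// -EFinB => /le_trans; apply; rewrite lee_fin.
apply: le_trans (expR_ge1Dx _); rewrite /s le_eqVlt; apply/orP; left; apply/eqP.
by field; rewrite gt_eqF.
Qed.

(** The tangent of exp at theta u lies below exp at the points 0 and u; averaging these two
    inequalities with weights 1 - theta and theta cancels the slopes. *)
Lemma expR_convex_unit (R : realType) (theta u : R) : 0 <= theta -> theta <= 1 ->
  expR (theta * u) <= 1 - theta + theta * expR u.
Proof.
move=> t0 t1; set E := expR (theta * u).
have E0 : 0 < E by exact: expR_gt0.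
have h1 : E * (1 + (1 - theta) * u) <= expR u.
  rewrite [leRHS](_ : _ = E * expR ((1 - theta) * u)); last first.
    by rewrite -expRD; congr expR; lra.
  by rewrite (ler_wpM2l (ltW E0))// expR_ge1Dx.
have h2 : E * (1 + - (theta * u)) <= 1.
  rewrite [leRHS](_ : _ = E * expR (- (theta * u))); last first.
    by rewrite -expRD subrr expR0.
  by rewrite (ler_wpM2l (ltW E0))// expR_ge1Dx.
have := ler_wpM2l t0 h1; have := @ler_wpM2l _ (1 - theta) _ _ _ h2.
rewrite subr_ge0 => /(_ t1); lra.
Qed.

(** The linear term has mean zero when x is a multiple of a centered variable, so only the
    exponential of a square is left to control. *)
Lemma expR_le_linear_sqr (R : realType) (x : R) : expR x <= x + expR (2 * x ^+ 2).
Proof.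
have [x1|x1] := leP (1 / 2) x.
  have : expR x <= expR (2 * x ^+ 2) by rewrite ler_expR; nra.
  lra.
have : expR x <= 1 + x + 2 * x ^+ 2.
  rewrite -[x in expR x]opprK expRN -[leLHS]mul1r ler_pdivrMr ?expR_gt0//.
  apply: (@le_trans _ _ ((1 + x + 2 * x ^+ 2) * (1 - x))).
    have : 0 <= x ^+ 2 * (1 - 2 * x) by rewrite mulr_ge0 ?sqr_ge0//; lra.
    by lra.
  rewrite ler_wpM2l ?expR_ge1Dx//.
  by have := sqr_ge0 (x + 1 / 4); lra.
have := expR_ge1Dx (2 * x ^+ 2); lra.
Qed.

(** Two regimes for th = 2 s^2 a^2. If th <= 1, the centering removes the linear term of
    [expR_le_linear_sqr], and exp(th Z^2 / a^2) is interpolated between 1 and exp(Z^2 / a^2); the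
    result is at most 1 + 2 th, by e <= 3. If th > 1, completing the square gives s Z <= s^2 a^2 +
    Z^2 / a^2, and the extra factor e is absorbed in the exponent. *)
Lemma psi2_mgf d (T : measurableType d) (R : realType)
    (P : probability T R) (Z : T -> R) (a s : R) :
  measurable_fun setT Z -> mean_zero P Z -> 0 < a ->
  (\int[P]_w (expR (Z w ^+ 2 / a ^+ 2))%:E <= (expR 1)%:E)%E ->
  (\int[P]_w (expR (s * Z w))%:E <= (expR (4 * (s ^+ 2 * a ^+ 2)))%:E)%E.
Proof.
move=> mZ [iZ]; rewrite unlock => EZ a0 psi.
have a20 : 0 < a ^+ 2 by rewrite exprn_gt0.
pose th := 2 * (s ^+ 2 * a ^+ 2).
have th0 : 0 <= th by rewrite mulr_ge0// mulr_ge0 ?sqr_ge0.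
pose q w := expR (Z w ^+ 2 / a ^+ 2).
have q0 w : 0 <= q w by exact: expR_ge0.
have mq : measurable_fun setT q.
  apply: measurableT_comp => //; apply: measurable_funM => //.
  exact: measurable_funX.
have ms : measurable_fun setT (fun w => expR (s * Z w)).
  by apply: measurableT_comp => //; exact: measurable_funM.
have s0 w : 0 <= expR (s * Z w) by exact: expR_ge0.
have [th1|th1] := leP th 1.
  pose g w := 1 - th + th * q w.
  have thq0 w : 0 <= th * q w by rewrite mulr_ge0.
  have g0 w : 0 <= g w by rewrite addr_ge0// subr_ge0.
  have mthq : measurable_fun setT (fun w => th * q w) by exact: measurable_funM.
  have mg : measurable_fun setT g by exact: measurable_funD.
  have Eg : (\int[P]_w (g w)%:E <= (1 - th + th * expR 1)%:E)%E.
    rewrite ge0_integralD_EFin//; last by move=> _; rewrite subr_ge0.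
    rewrite integral_cst_EFin ge0_integralZl_EFin_fun//.
    by rewrite [leRHS]EFinD leeD2l// [leRHS]EFinM lee_wpmul2l ?lee_fin.
  have ig : P.-integrable setT (EFin \o g).
    apply/integrableP; split; first exact/measurable_EFinP.
    under eq_integral => w _ do rewrite /= ger0_norm//.
    by apply: le_lt_trans Eg _; rewrite ltry.
  have isZ : P.-integrable setT (EFin \o (fun w => s * Z w)).
    by have := integrableZl measurableT s iZ; apply: eq_integrable.
  have ptw w : expR (s * Z w) <= s * Z w + g w.
    apply: le_trans (expR_le_linear_sqr _) _; rewrite lerD2l.
    rewrite (_ : 2 * (s * Z w) ^+ 2 = th * (Z w ^+ 2 / a ^+ 2)); last first.
      by rewrite /th; field; rewrite gt_eqF.
    exact: expR_convex_unit.
  apply: le_trans (ge0_le_integral_EFin _ _ _ s0 ptw) _ => //.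
    by apply: measurable_funD => //; exact: measurable_funM.
  rewrite integralD_EFin//.
  rewrite (_ : \int[P]_x (s * Z x)%:E = 0)%E ?add0e; last first.
    under eq_integral => w _ do rewrite EFinM.
    by rewrite integralZl// EZ mule0.
  apply: le_trans Eg _; rewrite lee_fin.
  apply: (@le_trans _ _ (1 + 2 * th)).
    have := ler_wpM2l th0 (expR1_le3 R); lra.
  apply: le_trans (expR_ge1Dx _) _; rewrite ler_expR /th; lra.
have ptw w : expR (s * Z w) <= expR (th / 2) * q w.
  rewrite -expRD ler_expR /th.
  rewrite -subr_ge0 (_ : _ - _ = (s * a - Z w / a / 2) ^+ 2 + 3 / 4 * (Z w / a) ^+ 2).
    by rewrite addr_ge0 ?sqr_ge0// mulr_ge0 ?sqr_ge0.
  by field; rewrite gt_eqF.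
have e0 : 0 <= expR (th / 2) by exact: expR_ge0.
apply: le_trans (ge0_le_integral_EFin _ _ _ s0 ptw) _ => //.
  exact: measurable_funM.
rewrite ge0_integralZl_EFin_fun//.
apply: (@le_trans _ _ ((expR (th / 2))%:E * (expR 1)%:E)%E).
  by rewrite lee_wpmul2l ?lee_fin.
by rewrite -EFinM -expRD lee_fin ler_expR; move: th1; rewrite /th; lra.
Qed.

(** A strict inequality is needed since the infimum may not be attained; admissible scales are
    closed upwards. *)
Lemma psi2_norm_lt d (T : measurableType d) (R : realType)
    (P : probability T R) (Z : T -> R) (sigma a : R) :
  measurable_fun setT Z -> (psi2_norm P Z <= sigma%:E)%E -> sigma < a ->
  0 < a /\ (\int[P]_w (expR (Z w ^+ 2 / a ^+ 2))%:E <= (expR 1)%:E)%E.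
Proof.
move=> mZ psi sa.
have : (psi2_norm P Z < a%:E)%E by apply: le_lt_trans psi _; rewrite lte_fin.
move=> /ereal_inf_lt[_ [b [b0 +] <-]]; rewrite unlock lte_fin => Eb ba.
have a0 : 0 < a by exact: lt_trans ba.
split => //; apply: le_trans Eb; apply: ge0_le_integral_EFin.
- apply: measurableT_comp => //; apply: measurable_funM => //.
  exact: measurable_funX.
- apply: measurableT_comp => //; apply: measurable_funM => //.
  exact: measurable_funX.
- by move=> w; exact: expR_ge0.
move=> w; rewrite ler_expR ler_wpM2l ?sqr_ge0// lef_pV2 ?posrE ?exprn_gt0//.
by rewrite lerXn2r ?nnegrE ?ltW.
Qed.

(** The square expands into products with signed coefficients; the finite second moments make each
    product integrable, through |xy| <= x^2 + y^2, so that the integral is linear here. *)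
Lemma integral_inner_sqr d (T : measurableType d) (R : realType)
    (P : probability T R) (p : nat) (Z : T -> 'cV[R]_p) (S : 'M[R]_p)
    (u : 'cV[R]_p) :
  (forall j, measurable_fun setT (fun w => Z w j 0)) ->
  mean_zero_vec P Z ->
  (forall j, (\int[P]_w (Z w j 0 ^+ 2)%:E < +oo)%E) ->
  covariance_mx P Z S ->
  (\int[P]_w (inner u (Z w) ^+ 2)%:E = (inner u (S *m u))%:E)%E.
Proof.
move=> mZ EZ Z2 cov.
have SE j k : (\int[P]_w (Z w j 0 * Z w k 0)%:E = (S j k)%:E)%E.
  rewrite -cov unlock; have [_ ->] := EZ j; have [_ ->] := EZ k.
  by rewrite unlock; apply: eq_integral => w _; rewrite mulrfctE/= !subr0.
have ijk j k : P.-integrable setT (fun w => (Z w j 0 * Z w k 0)%:E).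
  apply/integrableP; split.
    by apply/measurable_EFinP; exact: measurable_funM.
  under eq_integral => w _ do rewrite abse_EFin.
  apply: (@le_lt_trans _ _
      (\int[P]_w (Z w j 0 ^+ 2 + Z w k 0 ^+ 2)%:E)%E).
    apply: ge0_le_integral_EFin => //.
    - by apply: measurableT_comp => //; exact: measurable_funM.
    - by apply: measurable_funD; exact: measurable_funX.
    - move=> w; rewrite ler_norml.
      have := sqr_ge0 (Z w j 0 - Z w k 0); have := sqr_ge0 (Z w j 0 + Z w k 0).
      have := sqr_ge0 (Z w j 0); have := sqr_ge0 (Z w k 0).
      by move=> *; apply/andP; split; lra.
  rewrite ge0_integralD_EFin//; try (by exact: measurable_funX);
    try (by move=> w; exact: sqr_ge0).
  by rewrite lte_add_pinfty.
transitivity (\int[P]_w (\sum_(jk : 'I_p * 'I_p)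
    (u jk.1 0 * u jk.2 0)%:E * (Z w jk.1 0 * Z w jk.2 0)%:E))%E.
  apply: eq_integral => w _; rewrite sumEFin.
  rewrite -(pair_bigA _ (fun j k => u j 0 * u k 0 * (Z w j 0 * Z w k 0)))/=.
  congr EFin; rewrite expr2 /inner big_distrl/=; apply: eq_bigr => j _.
  by rewrite big_distrr/=; apply: eq_bigr => k _; rewrite mulrACA.
rewrite integral_sum//; last by move=> jk; apply: integrableZl.
rewrite -(pair_bigA _ (fun j k =>
  (\int[P]_w ((u j 0 * u k 0)%:E * (Z w j 0 * Z w k 0)%:E))%E))/=.
rewrite /inner -sumEFin; apply: eq_bigr => j _.
rewrite !mxE mulr_sumr -sumEFin; apply: eq_bigr => k _.
by rewrite integralZl// SE -EFinM; congr EFin; ring.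
Qed.

(** * Quadratic forms on the l1 ball *)

Definition quadform (R : realType) (p : nat) (M : 'M[R]_p) (v : 'cV[R]_p) : R :=
  (v^T *m M *m v) 0 0.

Lemma quadformZ (R : realType) (p : nat) (M : 'M[R]_p) (c : R) (v : 'cV[R]_p) :
  quadform M (c *: v) = c ^+ 2 * quadform M v.
Proof.
rewrite /quadform [(c *: v)^T]linearZ/= -!scalemxAl -scalemxAr scalerA.
by rewrite [LHS]mxE -expr2.
Qed.

Lemma quadform_delta (R : realType) (p : nat) (M : 'M[R]_p) (j : 'I_p) :
  quadform M (delta_mx j 0) = M j j.
Proof.
rewrite /quadform -!mulmxA -colE mxE (bigD1 j)//= big1 ?addr0.
  by rewrite !mxE !eqxx mul1r.
by move=> i /negbTE ij; rewrite !mxE ij mul0r.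
Qed.

(* If a is drawn with probabilities q and has mean v, then
   E Q (z + a) = Q (z + v) + (E Q a - Q v). *)
Lemma quadform_convex_comb (R : realType) (p : nat) (M : 'M[R]_p)
    (I : finType) (a : I -> 'cV[R]_p) (q : I -> R) (v z : 'cV[R]_p) :
  \sum_i q i = 1 -> v = \sum_i q i *: a i ->
  \sum_i q i * quadform M (z + a i) =
  quadform M (z + v) + (\sum_i q i * quadform M (a i) - quadform M v).
Proof.
move=> q1 vE.
have QD u w : quadform M (u + w) = quadform M u + quadform M w
    + ((u^T *m M *m w) 0 0 + (w^T *m M *m u) 0 0).
  by rewrite /quadform [(u + w)^T]linearD/= !mulmxDl !mulmxDr !mxE; ring.
have E1 : \sum_i q i * (z^T *m M *m a i) 0 0 = (z^T *m M *m v) 0 0.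
  rewrite vE mulmx_sumr summxE; apply: eq_bigr => i _.
  by rewrite -scalemxAr [RHS]mxE.
have E2 : \sum_i q i * ((a i)^T *m M *m z) 0 0 = (v^T *m M *m z) 0 0.
  rewrite vE [(\sum_i _)^T]linear_sum/= !mulmx_suml summxE; apply: eq_bigr => i _.
  by rewrite [(q i *: a i)^T]linearZ/= -!scalemxAl [RHS]mxE.
under eq_bigr => i _ do rewrite QD !mulrDr.
by rewrite !big_split/= -mulr_suml q1 E1 E2 QD; ring.
Qed.

(* A derandomized form of Maurey's empirical method. *)
Lemma quadform_maurey (R : realType) (p : nat) (M : 'M[R]_p)
    (I : finType) (a : I -> 'cV[R]_p) (q : I -> R) (v w : 'cV[R]_p) (n : nat) :
  (forall i, 0 <= q i) -> \sum_i q i = 1 -> v = \sum_i q i *: a i ->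
  (forall s : n.-tuple I, 0 <= quadform M (w + \sum_(i <- s) a i)) ->
  0 <= quadform M (w + n%:R *: v)
       + n%:R * (\sum_i q i * quadform M (a i) - quadform M v).
Proof.
move=> q0 q1 vE; elim: n w => [|n IH] w H.
  by have := H [tuple]; rewrite big_nil scale0r mul0r !addr0.
set D := _ - _.
(* Condition on the first draw [a i], then average over it. Each draw replaced by its mean [v] costs
   one variance term [D]; drawn vectors are collected in [w], which is why the induction is uniform
   in [w]. *)
have : 0 <= \sum_i q i * (quadform M (w + a i + n%:R *: v) + n%:R * D).
  apply: sumr_ge0 => i _; apply: mulr_ge0 => //; apply: IH => s.
  by have := H [tuple of i :: s]; rewrite big_cons addrA.
under eq_bigr => i _ do rewrite mulrDr addrAC.
rewrite big_split/= -mulr_suml q1 (quadform_convex_comb _ _ q1 vE) -/D.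
rewrite (_ : w + n%:R *: v + v = w + n.+1%:R *: v); last first.
  by rewrite -addrA -natr1 scalerDl scale1r.
by rewrite -natr1; lra.
Qed.

(** These are the vertices of the unit l1 ball; the boolean is the sign. *)
Definition signed_basis (R : realType) (p : nat) (a : 'I_p * bool) : 'cV[R]_p :=
  (-1) ^+ a.2 *: delta_mx a.1 0.

(** The point x = v / B is the mean of a random vertex. With n = k+1 draws, Maurey's inequality
    reads 0 <= (k+1)^2 Q(x) + (k+1)(K - Q(x)) = (k+1)(k Q(x) + K), which explains tuples of length
    k+1 and a division by k. *)
Lemma quadform_l1_lower (R : realType) (p : nat) (M : 'M[R]_p)
    (v : 'cV[R]_p) (B K : R) (k : nat) :
  (0 < p)%N -> (0 < k)%N -> 0 < B -> l1norm v <= B ->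
  (forall j, M j j <= K) ->
  (forall s : k.+1.-tuple ('I_p * bool),
    0 <= quadform M (\sum_(a <- s) signed_basis R a)) ->
  - (B ^+ 2 * K / k%:R) <= quadform M v.
Proof.
move=> p0 k0 B0 vB MK H.
have pR : 0 < p%:R :> R by rewrite ltr0n.
have kR : 0 < k%:R :> R by rewrite ltr0n.
pose x := B^-1 *: v.
(* The missing mass 1 - |x|_1 is spread evenly over the coordinates and, in [q], equally over both
   signs: the weights then sum to one and the mean is unchanged. *)
pose c j := `|x j 0| + (1 - l1norm x) / p%:R.
have x1 : l1norm x <= 1.
  rewrite /l1norm; under eq_bigr => j _ do rewrite mxE normrM.
  by rewrite -mulr_sumr gtr0_norm ?invr_gt0// mulrC ler_pdivrMr// mul1r.
have cx j : `|x j 0| <= c j by rewrite lerDl divr_ge0 ?subr_ge0// ltW.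
pose q (a : 'I_p * bool) := (c a.1 + (-1) ^+ a.2 * x a.1 0) / 2.
have q0 a : 0 <= q a.
  have := cx a.1; rewrite ler_norml => /andP[h1 h2].
  by rewrite /q; case: a.2 => /=; rewrite ?expr1 ?expr0; lra.
have sum2 (f : 'I_p * bool -> R) : \sum_a f a = \sum_j (f (j, false) + f (j, true)).
  rewrite (eq_bigr (fun a => f (a.1, a.2))); last by case.
  rewrite -(pair_bigA _ (fun j b => f (j, b)))/=; apply: eq_bigr => j _.
  by rewrite big_bool addrC.
have q1 : \sum_a q a = 1.
  rewrite sum2 (eq_bigr c); last by move=> j _; rewrite /q/= expr0 expr1; lra.
  rewrite big_split/= sumr_const card_ord -/(l1norm x) -[_ *+ p]mulr_natr.
  by rewrite divfK ?gt_eqF//; lra.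
have xE : x = \sum_a q a *: signed_basis R a.
  apply/matrixP => j z; rewrite summxE ord1 sum2 (bigD1 j)//= big1 ?addr0.
    by rewrite /q /signed_basis !mxE !eqxx/= expr0 expr1; lra.
  by move=> i /negbTE ij; rewrite !mxE eq_sym ij/= !mulr0 addr0.
have := @quadform_maurey _ _ M _ (signed_basis R (p := p)) q x 0 k.+1 q0 q1 xE.
rewrite add0r quadformZ.
have H0 (s : k.+1.-tuple ('I_p * bool)) :
    0 <= quadform M (0 + \sum_(a <- s) signed_basis R a) by rewrite add0r.
move=> /(_ H0).
have qK : \sum_a q a * quadform M (signed_basis R a) <= K.
  rewrite -[K]mul1r -q1 mulr_suml; apply: ler_sum => a _; rewrite ler_wpM2l//.
  by rewrite quadformZ sqrr_sign mul1r quadform_delta.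
set S := \sum_a _ in qK *.
have -> : quadform M v = B ^+ 2 * quadform M x.
  by rewrite /x quadformZ exprVn mulrA divff ?mul1r// gt_eqF// exprn_gt0.
rewrite -natr1 => h.
have {}h : 0 <= k%:R * quadform M x + K by nra.
rewrite -mulrN -mulrA ler_wpM2l ?exprn_ge0 ?(ltW B0)//.
by rewrite mulrN -mulNr ler_pdivrMr// mulrC; lra.
Qed.

(** * Random design matrices *)

(** The generators alone: [sigma_mx Z] is by definition [<<s entry_events Z >>], and
    [g_sigma_algebraType] takes the generating family as its argument. *)
Definition entry_events d (T : measurableType d) (R : realType) (m n : nat)
    (Z : T -> 'M[R]_(m, n)) : set (set T) :=
  \bigcup_(ij in [set: 'I_m * 'I_n])
    preimage_set_system setT (fun w => Z w ij.1 ij.2) measurable.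

Lemma measurable_wrt_entry d (T : measurableType d) (R : realType) (m n : nat)
    (Z : T -> 'M[R]_(m, n)) i j :
  measurable_wrt (entry_events Z) (fun w => Z w i j).
Proof.
move=> _ B mB; apply: sub_sigma_algebra.
by exists (i, j) => //; exists B.
Qed.

Lemma entry_events_measurable d (T : measurableType d) (R : realType)
    (m n : nat) (Z : T -> 'M[R]_(m, n)) :
  random_mx Z -> entry_events Z `<=` measurable.
Proof. by move=> mZ A [[i j] _ [B mB <-]]; exact: mZ. Qed.

Lemma measurable_wrt_row d (T : measurableType d) (R : realType) (m n : nat)
    (Z : T -> 'M[R]_(m, n)) i j :
  measurable_wrt (entry_events (fun w => row i (Z w))) (fun w => Z w i j).
Proof.
have := measurable_wrt_entry (Z := fun w => row i (Z w)) 0 j.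
rewrite (_ : (fun w => row i (Z w) 0 j) = (fun w => Z w i j))//.
by apply/funext => w; rewrite mxE.
Qed.

Lemma random_mx_row d (T : measurableType d) (R : realType) (m n : nat)
    (Z : T -> 'M[R]_(m, n)) i :
  random_mx Z -> random_mx (fun w => row i (Z w)).
Proof. by move=> mZ k j; under eq_fun do rewrite mxE; exact: mZ. Qed.

Lemma integral_prod_rows_le d (T : measurableType d) (R : realType)
    (P : probability T R) (m n : nat) (Z : T -> 'M[R]_(m, n))
    (f : 'I_m -> T -> R) (b : 'I_m -> R) :
  random_mx Z -> independent_rows P Z ->
  (forall i, measurable_wrt (entry_events (fun w => row i (Z w))) (f i)) ->
  (forall i w, 0 <= f i w) ->
  (forall i, (\int[P]_w (f i w)%:E <= (b i)%:E)%E) ->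
  (\int[P]_w (\prod_(i < m) f i w)%:E <= (\prod_(i < m) b i)%:E)%E.
Proof.
move=> mZ indZ mf f0 fb.
have I0 i : (0 <= \int[P]_w (f i w)%:E)%E.
  by apply: integral_ge0 => w _; rewrite lee_fin.
have If i : (\int[P]_w (f i w)%:E = (fine (\int[P]_w (f i w)%:E))%:E)%E.
  by rewrite fineK// ge0_fin_numE// (le_lt_trans (fb i))// ltry.
rewrite (integral_prod_mutually_independent _ indZ mf f0 If); last first.
  by move=> i; apply: entry_events_measurable; exact: random_mx_row.
rewrite lee_fin; apply: ler_prod => i _.
by rewrite fine_ge0//= -lee_fin -If.
Qed.

Lemma measurable_wrt_expR_sqr d (T : measurableType d) (R : realType)
   (m n : nat) (X : T -> 'M[R]_(m, n)) (u : 'cV[R]_n) (t : R) i :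
  measurable_wrt (entry_events (fun w => row i (X w)))
    (fun w => expR (t * inner u (row i (X w))^T ^+ 2)).
Proof.
apply: measurableT_comp => //; apply: measurable_funM => //.
apply: measurable_funX; rewrite /inner; apply: measurable_sum => j.
apply: measurable_funM => //.
rewrite (_ : (fun _ => _) = (fun w => X w i j)); first exact: measurable_wrt_row.
by apply/funext => w; rewrite !mxE.
Qed.

Lemma random_mx_inner d (T : measurableType d) (R : realType)
   (m n : nat) (X : T -> 'M[R]_(m, n)) (u : 'cV[R]_n) i :
  random_mx X -> measurable_fun setT (fun w => inner u (row i (X w))^T).
Proof.
move=> mX; apply: measurable_sum => j; apply: measurable_funM => //.
rewrite (_ : (fun _ => _) = (fun w => X w i j)) ?mX//.
by apply/funext => w; rewrite !mxE.
Qed.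

Lemma integral_expR_sum_sqr_le d (T : measurableType d) (R : realType)
    (P : probability T R) (m n : nat) (X : T -> 'M[R]_(m, n))
    (u : 'cV[R]_n) (s b : R) :
  random_mx X -> independent_rows P X ->
  (forall i, (\int[P]_w (expR (s * inner u (row i (X w))^T ^+ 2))%:E
     <= (expR b)%:E)%E) ->
  (\int[P]_w (expR (s * \sum_(i < m) inner u (row i (X w))^T ^+ 2))%:E
     <= (expR (m%:R * b))%:E)%E.
Proof.
move=> mX indX H.
under eq_integral => w _ do rewrite mulr_sumr expR_sum.
rewrite expRM_natl -[m in _ ^+ m]card_ord -prodr_const.
apply: (integral_prod_rows_le mX indX) => // i.
exact: measurable_wrt_expR_sqr.
Qed.

(** The given constant enters only through its square and may be zero or negative; it is traded for
    a larger positive one. *)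
Lemma subgaussian_vec_le d (T : measurableType d) (R : realType)
    (P : probability T R) (p : nat) (L L' : R) (Z : T -> 'cV[R]_p) (u : 'cV[R]_p) :
  subgaussian_vec P L Z -> `|L| <= L' -> l2norm u = 1 ->
  forall delta : R, (\int[P]_w (expR (delta * inner u (Z w)))%:E
     <= (expR (delta ^+ 2 * L' ^+ 2 / 2))%:E)%E.
Proof.
move=> sg LL u1 delta; have := sg delta u u1; rewrite unlock => /le_trans; apply.
rewrite lee_fin ler_expR ler_wpM2r// ler_wpM2l ?sqr_ge0//.
by rewrite -[L ^+ 2]real_normK ?num_real// lerXn2r ?nnegrE// (le_trans _ LL).
Qed.

(* Conditionally on X the exponent is a sum of independent terms in xi. *)
Lemma integral_expR_noise_le d (T : measurableType d) (R : realType)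
    (P : probability T R) (m n : nat) (X : T -> 'M[R]_(m, n))
    (xi : T -> 'cV[R]_m) (L a t : R) (j : 'I_n) :
  random_mx X -> random_mx xi -> 0 < L -> 0 < a ->
  4 * t ^+ 2 * a ^+ 2 * L ^+ 2 <= 1 / 4 ->
  independent_rows P X -> independent_rows P xi ->
  independent2 P (sigma_mx X) (sigma_mx xi) ->
  (forall i (delta : R), (\int[P]_w (expR (delta * X w i j))%:E
     <= (expR (delta ^+ 2 * L ^+ 2 / 2))%:E)%E) ->
  (forall i (s : R), (\int[P]_w (expR (s * xi w i 0))%:E
     <= (expR (4 * (s ^+ 2 * a ^+ 2)))%:E)%E) ->
  (\int[P]_w (expR (t * \sum_(i < m) xi w i 0 * X w i j))%:E
    <= (expR (m%:R * (8 * t ^+ 2 * a ^+ 2 * L ^+ 2)))%:E)%E.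
Proof.
move=> mX mxi L0 a0 taL indX indxi ind sgX sgxi.
pose h (z : T * T) := expR (t * \sum_(i < m) xi z.2 i 0 * X z.1 i j).
have h0 z : 0 <= h z by exact: expR_ge0.
have FX := entry_events_measurable mX.
have Fxi := entry_events_measurable mxi.
have mh : @measurable_fun _ _ (g_sigma_algebraType (entry_events X)
    * g_sigma_algebraType (entry_events xi))%type R setT h.
  apply: measurableT_comp => //; apply: measurable_funM => //.
  apply: measurable_sum => i; apply: measurable_funM.
  - by apply: measurableT_comp (measurable_wrt_entry (Z := xi) i 0) _.
  - by apply: measurableT_comp (measurable_wrt_entry (Z := X) i j) _.
have mhT : measurable_fun setT (fun z : T * T => (h z)%:E).
  apply/measurable_EFinP/measurableT_comp => //; apply: measurable_funM => //.
  apply: measurable_sum => i; apply: measurable_funM.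
  - by apply: measurableT_comp (mxi i 0) _.
  - by apply: measurableT_comp (mX i j) _.
have := ge0_integral_independent2 FX Fxi ind mh h0; rewrite [in X in X = _]/h/= => ->.
have mexi i w : measurable_wrt (entry_events (fun y => row i (xi y)))
    (fun y => expR (t * X w i j * xi y i 0)).
  apply: measurableT_comp => //; apply: measurable_funM => //.
  exact: measurable_wrt_row.
(* With X frozen at [w], the bound on the noise is used at s = t X_ij for each row. *)
have E1 w : (\int[P]_y (expR (t * (\sum_(i < m) xi y i 0 * X w i j)))%:E
   <= (expR (4 * t ^+ 2 * a ^+ 2 * \sum_(i < m) X w i j ^+ 2))%:E)%E.
  under eq_integral => y _ do rewrite mulr_sumr expR_sum.
  under eq_integral => y _.
    under eq_bigr => i _ do rewrite mulrA mulrAC.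
    over.
  rewrite mulr_sumr expR_sum.
  apply: (integral_prod_rows_le mxi indxi) => // i.
  apply: le_trans (sgxi i _) _; rewrite lee_fin ler_expR.
  by rewrite exprMn le_eqVlt; apply/orP; left; apply/eqP; ring.
apply: (@le_trans _ _ (\int[P]_w
    (expR (4 * t ^+ 2 * a ^+ 2 * \sum_(i < m) X w i j ^+ 2))%:E)%E).
  apply: ge0_le_integral => //.
  - by move=> w _; apply: integral_ge0 => y _; rewrite lee_fin expR_ge0.
  - exact: (measurable_fun_fubini_tonelli_F (fun z : T * T => (h z)%:E)).
  - apply/measurable_EFinP; apply: measurableT_comp => //.
    apply: measurable_funM => //; apply: measurable_sum => i.
    by apply: measurable_funX; exact: mX.
  - by move=> w _; exact: E1.
have innerE w i : inner (delta_mx j 0) (row i (X w))^T = X w i j.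
  rewrite /inner (bigD1 j)//= big1 ?addr0; first by rewrite !mxE !eqxx mul1r.
  by move=> k /negbTE kj; rewrite !mxE kj mul0r.
under eq_integral => w _.
  under eq_bigr => i _ do rewrite -innerE.
  over.
rewrite [in leRHS](_ : 8 * t ^+ 2 * a ^+ 2 * L ^+ 2 =
  2 * (4 * t ^+ 2 * a ^+ 2 * L ^+ 2)); last by ring.
(* The smallness assumption on [t] is the one [subgaussian_sqr_mgf] requires at exponent 4 t^2 a^2;
   its factor 2 turns 4 into 8. *)
apply: (integral_expR_sum_sqr_le mX indX) => i.
under eq_integral => w _ do rewrite innerE.
by apply: subgaussian_sqr_mgf => //; rewrite mulr_ge0 ?sqr_ge0// mulr_ge0 ?sqr_ge0.
Qed.

(** * The deterministic error bound *)

Lemma l2norm_sqr (R : realType) (p : nat) (v : 'cV[R]_p) :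
  l2norm v ^+ 2 = \sum_(j < p) v j 0 ^+ 2.
Proof. by rewrite sqr_sqrtr// sumr_ge0// => j _; exact: sqr_ge0. Qed.

Lemma l2norm_sqr_le_l1norm (R : realType) (p : nat) (v : 'cV[R]_p) :
  l2norm v ^+ 2 <= l1norm v ^+ 2.
Proof.
rewrite l2norm_sqr [leRHS]expr2 {1}/l1norm mulr_suml; apply: ler_sum => j _.
rewrite -[leLHS]real_normK ?num_real// expr2 ler_wpM2l// /l1norm.
by rewrite (bigD1 j)//= lerDl sumr_ge0.
Qed.

Lemma l1normB (R : realType) (p : nat) (u v : 'cV[R]_p) :
  l1norm (u - v) <= l1norm u + l1norm v.
Proof.
rewrite /l1norm -big_split/=; apply: ler_sum => j _; rewrite !mxE.
exact: ler_normB.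
Qed.

Lemma l1_ball_diameter (R : realType) (p : nat) (r : R) (u v : 'cV[R]_p) :
  l1norm u <= r -> l1norm v <= r -> l1norm (u - v) <= 2 * r.
Proof. by move=> ur vr; apply: le_trans (l1normB _ _) _; lra. Qed.

Lemma l2norm_sqr_le_l1_bound (R : realType) (p : nat) (B : R) (v : 'cV[R]_p) :
  l1norm v <= B -> l2norm v ^+ 2 <= B ^+ 2.
Proof.
move=> vB; apply: le_trans (l2norm_sqr_le_l1norm _) _.
have v0 : 0 <= l1norm v by exact: sumr_ge0.
by rewrite lerXn2r ?nnegrE// (le_trans v0).
Qed.

Lemma quadform_gram (R : realType) (m n : nat) (X : 'M[R]_(m, n)) (c : R)
    (v : 'cV[R]_n) :
  quadform (X^T *m X - c%:M) v = l2norm (X *m v) ^+ 2 - c * l2norm v ^+ 2.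
Proof.
rewrite /quadform mulmxBr mulmxBl mxE; congr (_ + _).
  rewrite mulmxA -trmx_mul -mulmxA l2norm_sqr mxE; apply: eq_bigr => i _.
  by rewrite mxE expr2.
rewrite mul_mx_scalar -scalemxAl !mxE l2norm_sqr; congr (- (_ * _)).
by apply: eq_bigr => i _; rewrite mxE expr2.
Qed.

Lemma lasso_basic_inequality (R : realType) (N p : nat) (r : R)
    (X : 'M[R]_(N, p)) (xi : 'cV[R]_N) (beta b : 'cV[R]_p) :
  (0 < N)%N -> l1norm beta <= r -> lasso_argmin r X (X *m beta + xi) b ->
  l2norm (X *m (b - beta)) ^+ 2 <= 2 * inner xi (X *m (b - beta)).
Proof.
move=> N0 betar [_ /(_ _ betar)].
rewrite /lasso_loss ler_pM2l ?invr_gt0 ?ltr0n//.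
have -> : X *m beta + xi - X *m beta = xi by rewrite addrAC subrr add0r.
have -> : X *m beta + xi - X *m b = xi - X *m (b - beta).
  by rewrite mulmxBr opprB addrA [xi + _]addrC.
set z := X *m (b - beta).
rewrite !l2norm_sqr => H.
have E : \sum_(i < N) (xi - z) i 0 ^+ 2 = \sum_(i < N) xi i 0 ^+ 2
    + \sum_(i < N) z i 0 ^+ 2 - 2 * inner xi z.
  rewrite /inner mulr_sumr -big_split -sumrB/=; apply: eq_bigr => i _.
  by rewrite !mxE; ring.
by move: H; rewrite E; lra.
Qed.

Lemma inner_mulmx_le (R : realType) (N p : nat) (X : 'M[R]_(N, p))
    (xi : 'cV[R]_N) (v : 'cV[R]_p) (K : R) :
  (forall j, `|\sum_(i < N) xi i 0 * X i j| <= K) ->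
  inner xi (X *m v) <= l1norm v * K.
Proof.
move=> H.
rewrite (_ : inner _ _ = \sum_j v j 0 * \sum_(i < N) xi i 0 * X i j).
  rewrite /l1norm mulr_suml; apply: ler_sum => j _.
  by apply: le_trans (ler_norm _) _; rewrite normrM ler_wpM2l.
rewrite /inner; under eq_bigr => i _ do rewrite mxE mulr_sumr.
rewrite exchange_big/=; apply: eq_bigr => j _; rewrite mulr_sumr.
by apply: eq_bigr => i _; ring.
Qed.

(** [F1] and [F2] stand for failure indicators but may be any nonnegative numbers. As soon as one of
    them is at least 1, the diameter bound 4 r^2 is below the first term; otherwise both good
    properties hold and the basic inequality meets [quadform_l1_lower] for the matrix X^T X - N c I
    at radius 2r. *)
Lemma lasso_error_le (R : realType) (N p k : nat) (r c K M F1 F2 : R)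
    (X : 'M[R]_(N, p)) (xi : 'cV[R]_N) (beta b : 'cV[R]_p) :
  (0 < N)%N -> (0 < p)%N -> (0 < k)%N -> 0 < r -> 0 < c -> 0 <= K -> 0 <= M ->
  0 <= F1 -> 0 <= F2 ->
  l1norm beta <= r -> lasso_argmin r X (X *m beta + xi) b ->
  (F1 < 1 -> forall s : k.+1.-tuple ('I_p * bool),
    let u := \sum_(a <- s) signed_basis R a in
    N%:R * c * l2norm u ^+ 2 <= l2norm (X *m u) ^+ 2) ->
  (F2 < 1 -> forall j, \sum_(i < N) X i j ^+ 2 <= K * N%:R) ->
  (forall j, `|\sum_(i < N) xi i 0 * X i j| <= M) ->
  l2norm (b - beta) ^+ 2 <= 4 * r ^+ 2 * (F1 + F2)
    + c^-1 * (4 * r ^+ 2 * K / k%:R + 4 * r * (M / N%:R)).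
Proof.
move=> N0 p0 k0 r0 c0 K0 M0 F10 F20 betar minb H1 H2 HM.
have NR : 0 < N%:R :> R by rewrite ltr0n.
have kR : 0 < k%:R :> R by rewrite ltr0n.
set v := b - beta.
have v1 : l1norm v <= 2 * r by apply: l1_ball_diameter => //; have [] := minb.
have v2 : l2norm v ^+ 2 <= 4 * r ^+ 2.
  by have := l2norm_sqr_le_l1_bound v1; lra.
have r2 : 0 < r ^+ 2 by rewrite exprn_gt0.
have T0 : 0 <= c^-1 * (4 * r ^+ 2 * K / k%:R + 4 * r * (M / N%:R)).
  have kV : 0 <= k%:R^-1 :> R by rewrite invr_ge0 ltW.
  have NV : 0 <= N%:R^-1 :> R by rewrite invr_ge0 ltW.
  have cV : 0 <= c^-1 by rewrite invr_ge0 ltW.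
  rewrite mulr_ge0// addr_ge0//.
    by rewrite !mulr_ge0// ltW.
  by rewrite mulr_ge0// ?mulr_ge0// ltW.
have big F : 1 <= F -> 4 * r ^+ 2 * F >= 4 * r ^+ 2.
  by move=> F_1; rewrite ler_peMr// mulr_ge0// ltW.
have [F1_1|F1_1] := leP 1 F1.
  have := big F1 F1_1; have : 0 <= 4 * r ^+ 2 * F2 by rewrite mulr_ge0// mulr_ge0// ltW.
  lra.
have [F2_1|F2_1] := leP 1 F2.
  have := big F2 F2_1; have : 0 <= 4 * r ^+ 2 * F1 by rewrite mulr_ge0// mulr_ge0// ltW.
  lra.
suff S : l2norm v ^+ 2 <= c^-1 * (4 * r ^+ 2 * K / k%:R + 4 * r * (M / N%:R)).
  have : 0 <= 4 * r ^+ 2 * (F1 + F2) by rewrite mulr_ge0 ?addr_ge0// mulr_ge0// ltW.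
  lra.
have r20 : 0 < 2 * r by rewrite mulr_gt0.
have := @quadform_l1_lower _ _ (X^T *m X - (N%:R * c)%:M) v (2 * r) (K * N%:R) k
  p0 k0 r20 v1.
have D j : (X^T *m X - (N%:R * c)%:M) j j <= K * N%:R.
  have -> : (X^T *m X - (N%:R * c)%:M) j j = \sum_(i < N) X i j ^+ 2 - N%:R * c.
    rewrite !mxE eqxx; congr (_ - _); apply: eq_bigr => i _.
    by rewrite mxE expr2.
  have := H2 F2_1 j; have : 0 <= N%:R * c by rewrite mulr_ge0 ?ltW.
  lra.
move=> /(_ D) /(_ _)-L.
have {}L : - ((2 * r) ^+ 2 * (K * N%:R) / k%:R) <=
    l2norm (X *m v) ^+ 2 - N%:R * c * l2norm v ^+ 2.
  rewrite -quadform_gram; apply: L => s.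
  by rewrite quadform_gram subr_ge0; exact: H1.
have B1 := lasso_basic_inequality N0 betar minb; rewrite -/v in B1.
have B2 := inner_mulmx_le v HM.
have B3 : l1norm v * M <= 2 * r * M by rewrite ler_wpM2r.
have B4 : N%:R * c * l2norm v ^+ 2 <=
    (2 * r) ^+ 2 * (K * N%:R) / k%:R + 4 * r * M by lra.
rewrite -(ler_pM2l (mulr_gt0 NR c0)); apply: le_trans B4 _.
rewrite le_eqVlt; apply/orP; left; apply/eqP.
by field; rewrite !gt_eqF.
Qed.

(** * Union bounds *)

Lemma inner_delta (R : realType) (p : nat) (v : 'cV[R]_p) (j : 'I_p) :
  inner (delta_mx j 0) v = v j 0.
Proof.
rewrite /inner (bigD1 j)//= big1 ?addr0; first by rewrite !mxE !eqxx mul1r.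
by move=> k /negbTE kj; rewrite !mxE kj mul0r.
Qed.

Lemma l2norm_delta (R : realType) (p : nat) (j : 'I_p) :
  l2norm (delta_mx j 0 : 'cV[R]_p) = 1.
Proof.
rewrite /l2norm (bigD1 j)//= big1 ?addr0 ?mxE ?eqxx ?expr1n ?sqrtr1//.
by move=> k /negbTE kj; rewrite !mxE kj expr0n.
Qed.

Lemma l2norm_gt0 (R : realType) (p : nat) (u : 'cV[R]_p) :
  u != 0 -> 0 < l2norm u.
Proof.
move=> u0; rewrite lt_neqAle sqrtr_ge0 andbT eq_sym; apply: contra u0 => /eqP h.
have /eqP : l2norm u ^+ 2 = 0 by rewrite h expr0n.
rewrite l2norm_sqr psumr_eq0; last by move=> j _; exact: sqr_ge0.
move=> /allP H; apply/eqP/matrixP => j z; rewrite ord1 mxE.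
by have := H j (mem_index_enum j); rewrite sqrf_eq0 => /eqP.
Qed.

Lemma l2normZ (R : realType) (p : nat) (c : R) (u : 'cV[R]_p) :
  l2norm (c *: u) = `|c| * l2norm u.
Proof.
rewrite /l2norm; under eq_bigr => j _ do rewrite mxE exprMn.
by rewrite -mulr_sumr sqrtrM ?sqr_ge0// sqrtr_sqr.
Qed.

Lemma l2norm_mulmx (R : realType) (m n : nat) (X : 'M[R]_(m, n)) (u : 'cV[R]_n) :
  l2norm (X *m u) ^+ 2 = \sum_(i < m) inner u (row i X)^T ^+ 2.
Proof.
rewrite l2norm_sqr; apply: eq_bigr => i _; rewrite mxE; congr (_ ^+ 2).
by apply: eq_bigr => j _; rewrite !mxE mulrC.
Qed.

Lemma subgaussian_sqr_lty d (T : measurableType d) (R : realType)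
    (P : probability T R) (Z : T -> R) (L : R) :
  measurable_fun setT Z -> 0 < L ->
  (forall delta : R, (\int[P]_w (expR (delta * Z w))%:E
     <= (expR (delta ^+ 2 * L ^+ 2 / 2))%:E)%E) ->
  (\int[P]_w (Z w ^+ 2)%:E < +oo)%E.
Proof.
move=> mZ L0 sg; have L20 : 0 < L ^+ 2 by rewrite exprn_gt0.
pose s := (4 * L ^+ 2)^-1.
have s0 : 0 < s by rewrite invr_gt0 mulr_gt0.
have sL : s * L ^+ 2 <= 1 / 4.
  by rewrite le_eqVlt; apply/orP; left; apply/eqP; rewrite /s; field; rewrite gt_eqF.
have Es := subgaussian_sqr_mgf mZ sg (ltW s0) sL.
have me : measurable_fun setT (fun w => expR (s * Z w ^+ 2)).
  apply: measurableT_comp => //; apply: measurable_funM => //.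
  exact: measurable_funX.
apply: (@le_lt_trans _ _ (\int[P]_w (s^-1 * expR (s * Z w ^+ 2))%:E)%E).
  apply: ge0_le_integral_EFin => //.
  - exact: measurable_funX.
  - exact: measurable_funM.
  - by move=> w; exact: sqr_ge0.
  - move=> w; rewrite mulrC ler_pdivlMr// mulrC.
    by have := expR_ge1Dx (s * Z w ^+ 2); lra.
have sV : 0 <= s^-1 by rewrite invr_ge0 ltW.
have e0 w : 0 <= expR (s * Z w ^+ 2) by exact: expR_ge0.
rewrite ge0_integralZl_EFin_fun//.
apply: (@le_lt_trans _ _ ((s^-1)%R%:E * (expR (2 * (s * L ^+ 2)))%:E)%E).
  by apply: lee_wpmul2l => //; rewrite lee_fin.
by rewrite -EFinM ltry.
Qed.

(** The value t = lam / (128 L^4) minimizes 64 L^4 t^2 - t lam, with minimum -lam^2 / (256 L^4). The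
    threshold N lam / 4 gives back half of this gain. *)
Lemma integral_expR_lower_le d (T : measurableType d) (R : realType)
    (P : probability T R) (N p : nat) (X : T -> 'M[R]_(N, p)) (Sigma : 'M[R]_p)
    (L0 L lam : R) (u : 'cV[R]_p) :
  random_mx X -> independent_rows P X ->
  (forall i, mean_zero_vec P (fun w => (row i (X w))^T)) ->
  (forall i, subgaussian_vec P L0 (fun w => (row i (X w))^T)) ->
  (forall i, covariance_mx P (fun w => (row i (X w))^T) Sigma) ->
  loewner_le lam%:M Sigma -> 0 < lam -> `|L0| <= L -> 0 < L ->
  l2norm u = 1 ->
  (\int[P]_w (expR (lam / (128 * L ^+ 4) *
      (N%:R * (lam / 4) - \sum_(i < N) inner u (row i (X w))^T ^+ 2)))%:E
    <= (expR (- (N%:R * (lam ^+ 2 / (512 * L ^+ 4)))))%:E)%E.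
Proof.
move=> mX indX EX sgX covX loew lam0 LL L_gt0 u1.
have L4 : 0 < L ^+ 4 by rewrite exprn_gt0.
set t := lam / (128 * L ^+ 4).
have t0 : 0 < t by rewrite divr_gt0// mulr_gt0.
have lam_le i : (lam%:E <= \int[P]_w (inner u (row i (X w))^T ^+ 2)%:E)%E.
  rewrite (integral_inner_sqr (S := Sigma))//.
  - rewrite lee_fin; have [_ /(_ u)] := loew.
    rewrite mulmxBl mul_scalar_mx.
    have -> : inner u (Sigma *m u - lam *: u) =
        inner u (Sigma *m u) - lam * l2norm u ^+ 2.
      rewrite l2norm_sqr mulr_sumr /inner -sumrB; apply: eq_bigr => j _.
      by rewrite !mxE; ring.
    by rewrite u1; lra.
  - move=> j; rewrite (_ : (fun _ => _) = (fun w => X w i j)) ?mX//.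
    by apply/funext => w; rewrite !mxE.
  - move=> j; apply: (subgaussian_sqr_lty (L := L)) => //.
      rewrite (_ : (fun _ => _) = (fun w => X w i j)) ?mX//.
      by apply/funext => w; rewrite !mxE.
    move=> delta; have := subgaussian_vec_le (sgX i) LL (l2norm_delta R j) delta.
    by under eq_integral => w _ do rewrite inner_delta.
have main : (\int[P]_w (expR (- t * \sum_(i < N) inner u (row i (X w))^T ^+ 2))%:E
    <= (expR (N%:R * (64 * L ^+ 4 * t ^+ 2 - t * lam)))%:E)%E.
  apply: integral_expR_sum_sqr_le => // i.
  have := subgaussian_lower_mgf (random_mx_inner u i mX)
    (subgaussian_vec_le (sgX i) LL u1) (lam_le i) L_gt0 (ltW t0).
  by under eq_integral => w _ do rewrite -mulNr.
under eq_integral => w _ do rewrite mulrBr -mulNr expRD.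
rewrite ge0_integralZl_EFin_fun ?expR_ge0//; last first.
  apply: measurableT_comp => //; apply: measurable_funM => //.
  by apply: measurable_sum => i; apply: measurable_funX; exact: random_mx_inner.
apply: le_trans (lee_wpmul2l _ main) _; first by rewrite lee_fin expR_ge0.
rewrite -EFinM -expRD lee_fin ler_expR le_eqVlt; apply/orP; left; apply/eqP.
by rewrite /t; field; rewrite gt_eqF.
Qed.

Definition signed_sum (R : realType) (p n : nat) (s : n.-tuple ('I_p * bool)) :
    'cV[R]_p := \sum_(a <- s) signed_basis R a.

Definition normalize (R : realType) (p : nat) (u : 'cV[R]_p) : 'cV[R]_p :=
  (l2norm u)^-1 *: u.

Lemma l2norm_normalize (R : realType) (p : nat) (u : 'cV[R]_p) :
  u != 0 -> l2norm (normalize u) = 1.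
Proof.
move=> /l2norm_gt0 u0; rewrite l2normZ ger0_norm ?invr_ge0 ?(ltW u0)//.
by rewrite mulVf// gt_eqF.
Qed.

Lemma measurable_expR_inner_sqr d (T : measurableType d) (R : realType)
    (N p : nat) (X : T -> 'M[R]_(N, p)) (u : 'cV[R]_p) (t b : R) :
  random_mx X ->
  measurable_fun setT (fun w =>
    expR (t * (b - \sum_(i < N) inner u (row i (X w))^T ^+ 2))).
Proof.
move=> mX; apply: measurableT_comp => //; apply: measurable_funM => //.
apply: measurable_funB => //; apply: measurable_sum => i.
by apply: measurable_funX; exact: random_mx_inner.
Qed.

Lemma ge0_integral_sum_le d (T : measurableType d) (R : realType)
    (P : probability T R) (I : finType) (Q : pred I) (f : I -> T -> R) (b : R) :
  (forall i, measurable_fun setT (f i)) -> (forall i w, 0 <= f i w) ->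
  0 <= b -> (forall i, Q i -> (\int[P]_w (f i w)%:E <= b%:E)%E) ->
  (\int[P]_w (\sum_(i | Q i) f i w)%:E <= (#|I|%:R * b)%:E)%E.
Proof.
move=> mf f0 b0 H; rewrite ge0_integral_sum_EFin//.
apply: (@le_trans _ _ (\sum_(i | Q i) b%:E)%E); first exact: lee_sum.
rewrite sumEFin lee_fin sumr_const -[_ *+ _]mulr_natl ler_wpM2r// ler_nat.
exact: max_card.
Qed.

(** Sub-Gaussianity concerns unit vectors, hence the normalization. Signed basis vectors may cancel;
    such zero sums are left out, the lower bound being trivial there. *)
Lemma integral_sparse_fail_le d (T : measurableType d) (R : realType)
    (P : probability T R) (N p n : nat) (X : T -> 'M[R]_(N, p))
    (Sigma : 'M[R]_p) (L0 L lam : R) :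
  random_mx X -> independent_rows P X ->
  (forall i, mean_zero_vec P (fun w => (row i (X w))^T)) ->
  (forall i, subgaussian_vec P L0 (fun w => (row i (X w))^T)) ->
  (forall i, covariance_mx P (fun w => (row i (X w))^T) Sigma) ->
  loewner_le lam%:M Sigma -> 0 < lam -> `|L0| <= L -> 0 < L ->
  (\int[P]_w (\sum_(s : n.-tuple ('I_p * bool) | signed_sum R s != 0)
      expR (lam / (128 * L ^+ 4) * (N%:R * (lam / 4) -
        \sum_(i < N) inner (normalize (signed_sum R s)) (row i (X w))^T ^+ 2)))%:E
    <= ((p * 2) ^ n)%:R%:E * (expR (- (N%:R * (lam ^+ 2 / (512 * L ^+ 4)))))%:E)%E.
Proof.
move=> mX indX EX sgX covX loew lam0 LL L_gt0.
have -> : ((p * 2) ^ n)%N = #|{: n.-tuple ('I_p * bool)}|.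
  by rewrite card_tuple card_prod card_ord card_bool.
rewrite -EFinM; apply: ge0_integral_sum_le.
- by move=> s; exact: measurable_expR_inner_sqr.
- by move=> s w; exact: expR_ge0.
- exact: expR_ge0.
- move=> s s0; apply: (integral_expR_lower_le mX indX EX sgX covX) => //.
  exact: l2norm_normalize.
Qed.

Lemma subgaussian_vec_entry d (T : measurableType d) (R : realType)
    (P : probability T R) (N p : nat) (X : T -> 'M[R]_(N, p)) (L0 L : R) :
  (forall i, subgaussian_vec P L0 (fun w => (row i (X w))^T)) -> `|L0| <= L ->
  forall i j (delta : R), (\int[P]_w (expR (delta * X w i j))%:E
     <= (expR (delta ^+ 2 * L ^+ 2 / 2))%:E)%E.
Proof.
move=> sgX LL i j delta.
have := subgaussian_vec_le (sgX i) LL (l2norm_delta R j) delta.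
by under eq_integral => w _ do rewrite inner_delta !mxE.
Qed.

(** At exponent 1 / (4 L^2) the squared column contributes exp(N/2), and the threshold 10 L^2 N
    contributes exp(-5N/2). *)
Lemma integral_column_fail_le d (T : measurableType d) (R : realType)
    (P : probability T R) (N p : nat) (X : T -> 'M[R]_(N, p)) (L0 L : R) :
  random_mx X -> independent_rows P X ->
  (forall i, subgaussian_vec P L0 (fun w => (row i (X w))^T)) ->
  `|L0| <= L -> 0 < L ->
  (\int[P]_w (\sum_(j < p) expR ((4 * L ^+ 2)^-1 *
      (\sum_(i < N) X w i j ^+ 2 - 10 * L ^+ 2 * N%:R)))%:E
    <= p%:R%:E * (expR (- (2 * N%:R)))%:E)%E.
Proof.
move=> mX indX sgX LL L_gt0.
have L2 : 0 < L ^+ 2 by rewrite exprn_gt0.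
set t := (4 * L ^+ 2)^-1.
have t0 : 0 < t by rewrite invr_gt0 mulr_gt0.
have tL : t * L ^+ 2 = 1 / 4 by rewrite /t; field; rewrite gt_eqF.
have tL' : t * L ^+ 2 <= 1 / 4 by rewrite tL.
have mS j : measurable_fun setT (fun w => \sum_(i < N) X w i j ^+ 2).
  by apply: measurable_sum => i; apply: measurable_funX; exact: mX.
have -> : (p%:R%:E * (expR (- (2 * N%:R)))%:E =
    (#|'I_p|%:R * expR (- (2 * N%:R)))%:E :> \bar R)%E by rewrite card_ord EFinM.
apply: ge0_integral_sum_le.
- move=> j; apply: measurableT_comp => //; apply: measurable_funM => //.
  exact: measurable_funB.
- by move=> j w; exact: expR_ge0.
- exact: expR_ge0.
move=> j _.
have main : (\int[P]_w (expR (t * \sum_(i < N) X w i j ^+ 2))%:E <=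
    (expR (N%:R * (1 / 2)))%:E)%E.
  have E w i : X w i j = inner (delta_mx j 0) (row i (X w))^T.
    by rewrite inner_delta !mxE.
  under eq_integral => w _.
    under eq_bigr => i _ do rewrite E.
    over.
  apply: integral_expR_sum_sqr_le => // i.
  under eq_integral => w _ do rewrite -E.
  have := subgaussian_sqr_mgf (mX i j) (subgaussian_vec_entry sgX LL i j) (ltW t0) tL'.
  by rewrite tL (_ : 2 * (1 / 4) = 1 / 2)//; lra.
under eq_integral => w _ do rewrite mulrBr addrC expRD.
rewrite ge0_integralZl_EFin_fun ?expR_ge0//; last first.
  by apply: measurableT_comp => //; exact: measurable_funM.
apply: le_trans (lee_wpmul2l _ main) _; first by rewrite lee_fin expR_ge0.
rewrite -EFinM -expRD lee_fin ler_expR le_eqVlt; apply/orP; left; apply/eqP.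
by rewrite /t; field; rewrite gt_eqF.
Qed.

(** The sum over columns and over both signs of [t] dominates the exponential of t max_j |<X_j,
    xi>|. *)
Lemma integral_noise_sum_le d (T : measurableType d) (R : realType)
    (P : probability T R) (N p : nat) (X : T -> 'M[R]_(N, p))
    (xi : T -> 'cV[R]_N) (L0 L a t : R) :
  random_mx X -> random_mx xi ->
  independent_rows P X -> independent_rows P xi ->
  independent2 P (sigma_mx X) (sigma_mx xi) ->
  (forall i, subgaussian_vec P L0 (fun w => (row i (X w))^T)) ->
  `|L0| <= L -> 0 < L -> 0 < a ->
  (forall i (s : R), (\int[P]_w (expR (s * xi w i 0))%:E
     <= (expR (4 * (s ^+ 2 * a ^+ 2)))%:E)%E) ->
  4 * t ^+ 2 * a ^+ 2 * L ^+ 2 <= 1 / 4 ->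
  (\int[P]_w (\sum_(j < p) (expR (t * \sum_(i < N) xi w i 0 * X w i j) +
      expR (- t * \sum_(i < N) xi w i 0 * X w i j)))%:E
    <= (p%:R * (2 * expR (N%:R * (8 * t ^+ 2 * a ^+ 2 * L ^+ 2))))%:E)%E.
Proof.
move=> mX mxi indX indxi ind sgX LL L_gt0 a0 sgxi taL.
have me s j : measurable_fun setT (fun w => expR (s * \sum_(i < N) xi w i 0 * X w i j)).
  apply: measurableT_comp => //; apply: measurable_funM => //.
  by apply: measurable_sum => i; apply: measurable_funM; [exact: mxi|exact: mX].
rewrite -[p in p%:R]card_ord; apply: ge0_integral_sum_le.
- by move=> j; exact: measurable_funD.
- by move=> j w; rewrite addr_ge0 ?expR_ge0.
- by rewrite mulr_ge0 ?expR_ge0.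
move=> j _; rewrite ge0_integralD_EFin//; try by move=> w; exact: expR_ge0.
rewrite mulr2n mulrDl mul1r EFinD; apply: leeD.
  exact: integral_expR_noise_le (subgaussian_vec_entry sgX LL ^~ j) _.
rewrite -(sqrrN t); apply: integral_expR_noise_le => //.
- by rewrite sqrrN.
- by move=> i; exact: subgaussian_vec_entry sgX LL i j.
Qed.

(** * Expected error of the lasso *)

(** A bound affine in [W] in place of y <= log W: expectations pass through it directly, and [b] is
    chosen close to the logarithm of the mean of [W]. *)
Lemma le_linear_expR (R : realType) (y W b : R) :
  expR y <= W -> y <= b + W / expR b.
Proof.
move=> yW; have := expR_ge1Dx (y - b); rewrite expRD expRN.
have : expR y / expR b <= W / expR b by rewrite ler_wpM2r// invr_ge0 expR_ge0.
lra.
Qed.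

Lemma lasso_error_fails_le (R : realType) (N p k : nat) (r L lam t b : R)
    (X : 'M[R]_(N, p)) (xi : 'cV[R]_N) (beta v : 'cV[R]_p) :
  (0 < N)%N -> (0 < p)%N -> (0 < k)%N -> 0 < r -> 0 < L -> 0 < lam -> 0 < t ->
  0 <= b -> l1norm beta <= r -> lasso_argmin r X (X *m beta + xi) v ->
  l2norm (v - beta) ^+ 2 <= 4 * r ^+ 2 *
    (\sum_(s : k.+1.-tuple ('I_p * bool) | signed_sum R s != 0)
      expR (lam / (128 * L ^+ 4) * (N%:R * (lam / 4) -
        \sum_(i < N) inner (normalize (signed_sum R s)) (row i X)^T ^+ 2))
     + \sum_(j < p) expR ((4 * L ^+ 2)^-1 *
      (\sum_(i < N) X i j ^+ 2 - 10 * L ^+ 2 * N%:R)))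
   + (lam / 4)^-1 * (4 * r ^+ 2 * (10 * L ^+ 2) / k%:R + 4 * r * (t^-1 * (b +
     (\sum_(j < p) (expR (t * \sum_(i < N) xi i 0 * X i j) +
      expR (- t * \sum_(i < N) xi i 0 * X i j))) / expR b) / N%:R)).
Proof.
move=> N0 p0 k0 r0 L0 lam0 t0 b0 betar minv.
set W := (\sum_(j < p) (_ + _)).
have W0 : 0 <= W by apply: sumr_ge0 => j _; rewrite addr_ge0 ?expR_ge0.
apply: (lasso_error_le (X := X) (xi := xi)) => //.
- by rewrite divr_gt0.
- by rewrite mulr_ge0// sqr_ge0.
- by rewrite mulr_ge0 ?invr_ge0 ?(ltW t0)// addr_ge0// divr_ge0// expR_ge0.
- by apply: sumr_ge0 => s _; exact: expR_ge0.
- by apply: sumr_ge0 => s _; exact: expR_ge0.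
- move=> H s /=; rewrite -/(signed_sum R s); set u := signed_sum R s.
  have [u0|u0] := eqVneq u 0.
    by rewrite u0 mulmx0 !l2norm_sqr !big1 ?mulr0// => i _; rewrite mxE expr0n.
  (* A sum of nonnegative terms below 1 forces each exponential below 1, so its exponent is
     negative; this is the lower bound for the normalized vector, then rescaled. *)
  have : expR (lam / (128 * L ^+ 4) * (N%:R * (lam / 4) -
      \sum_(i < N) inner (normalize u) (row i X)^T ^+ 2)) < 1.
    apply: le_lt_trans H; rewrite (bigD1 s)//= lerDl.
    by apply: sumr_ge0 => s' _; exact: expR_ge0.
  rewrite expR_lt1 pmulr_rlt0; last by rewrite divr_gt0// mulr_gt0// exprn_gt0.
  rewrite subr_lt0 -l2norm_mulmx /normalize -scalemxAr l2normZ exprMn => h.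
  have u20 : 0 < l2norm u ^+ 2 by rewrite exprn_gt0// l2norm_gt0.
  move: h; rewrite ger0_norm ?invr_ge0 ?sqrtr_ge0// exprVn.
  by rewrite ltr_pdivlMl// mulrC => /ltW.
- move=> H j.
  have : expR ((4 * L ^+ 2)^-1 *
      (\sum_(i < N) X i j ^+ 2 - 10 * L ^+ 2 * N%:R)) < 1.
    apply: le_lt_trans H; rewrite (bigD1 j)//= lerDl.
    by apply: sumr_ge0 => s' _; exact: expR_ge0.
  rewrite expR_lt1 pmulr_rlt0; last by rewrite invr_gt0 mulr_gt0// exprn_gt0.
  by rewrite subr_lt0 => /ltW.
- move=> j; set S := \sum_(i < N) _.
  have WS : expR (t * S) + expR (- t * S) <= W.
    rewrite /W (bigD1 j)//= lerDl.
    by apply: sumr_ge0 => s' _; rewrite addr_ge0 ?expR_ge0.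
  have h1 : expR (t * S) <= W by have := expR_gt0 (- t * S); lra.
  have h2 : expR (- t * S) <= W by have := expR_gt0 (t * S); lra.
  have := le_linear_expR b h1; have := le_linear_expR b h2.
  by rewrite ler_pdivlMl//; case: (ger0P S) => _; lra.
Qed.

(** The pointwise bound is affine, with nonnegative coefficients, in the three random sums [f1],
    [f2] and [W], so their expectations are substituted term by term. *)
Lemma lasso_expected_error_le d (T : measurableType d) (R : realType)
    (P : probability T R) (N p k : nat) (r L0 L lam a t b : R)
    (X : T -> 'M[R]_(N, p)) (xi : T -> 'cV[R]_N) (beta : 'cV[R]_p)
    (Sigma : 'M[R]_p) (betahat : T -> 'cV[R]_p) :
  (0 < N)%N -> (0 < p)%N -> (0 < k)%N -> 0 < r -> 0 < L -> `|L0| <= L ->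
  0 < lam -> 0 < t -> 0 < a -> 0 <= b -> 4 * t ^+ 2 * a ^+ 2 * L ^+ 2 <= 1 / 4 ->
  l1norm beta <= r ->
  random_mx X -> random_mx xi -> random_mx betahat ->
  independent_rows P X ->
  (forall i, mean_zero_vec P (fun w => (row i (X w))^T)) ->
  (forall i, subgaussian_vec P L0 (fun w => (row i (X w))^T)) ->
  (forall i, covariance_mx P (fun w => (row i (X w))^T) Sigma) ->
  loewner_le lam%:M Sigma -> independent_rows P xi ->
  (forall i (s : R), (\int[P]_w (expR (s * xi w i 0))%:E
     <= (expR (4 * (s ^+ 2 * a ^+ 2)))%:E)%E) ->
  independent2 P (sigma_mx X) (sigma_mx xi) ->
  (forall w, lasso_argmin r (X w) (X w *m beta + xi w) (betahat w)) ->
  (\int[P]_w (l2norm (betahat w - beta) ^+ 2)%:E <=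
    (4 * r ^+ 2 *
      (((p * 2) ^ k.+1)%:R * expR (- (N%:R * (lam ^+ 2 / (512 * L ^+ 4))))
       + p%:R * expR (- (2 * N%:R)))
     + (lam / 4)^-1 * (4 * r ^+ 2 * (10 * L ^+ 2) / k%:R + 4 * r * (t^-1 * (b +
       (p%:R * (2 * expR (N%:R * (8 * t ^+ 2 * a ^+ 2 * L ^+ 2)))) / expR b)
        / N%:R)))%:E)%E.
Proof.
move=> N0 p0 k0 r0 L_gt0 LL lam0 t0 a0 b0 taL betar mX mxi mb indX EX sgX covX loew
  indxi sgxi ind minb.
pose f1 w := \sum_(s : k.+1.-tuple ('I_p * bool) | signed_sum R s != 0)
  expR (lam / (128 * L ^+ 4) * (N%:R * (lam / 4) -
    \sum_(i < N) inner (normalize (signed_sum R s)) (row i (X w))^T ^+ 2)).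
pose f2 w := \sum_(j < p) expR ((4 * L ^+ 2)^-1 *
  (\sum_(i < N) X w i j ^+ 2 - 10 * L ^+ 2 * N%:R)).
pose W w := \sum_(j < p) (expR (t * \sum_(i < N) xi w i 0 * X w i j) +
  expR (- t * \sum_(i < N) xi w i 0 * X w i j)).
have If1 : (\int[P]_w (f1 w)%:E <= _)%E :=
  integral_sparse_fail_le k.+1 mX indX EX sgX covX loew lam0 LL L_gt0.
have If2 : (\int[P]_w (f2 w)%:E <= _)%E :=
  integral_column_fail_le mX indX sgX LL L_gt0.
have IW : (\int[P]_w (W w)%:E <= _)%E :=
  integral_noise_sum_le mX mxi indX indxi ind sgX LL L_gt0 a0 sgxi taL.
have NR : 0 < N%:R :> R by rewrite ltr0n.
have kR : 0 < k%:R :> R by rewrite ltr0n.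
have W0 w : 0 <= W w by apply: sumr_ge0 => j _; rewrite addr_ge0 ?expR_ge0.
have f20 w : 0 <= f2 w by apply: sumr_ge0 => j _; exact: expR_ge0.
have f10 w : 0 <= f1 w by apply: sumr_ge0 => j _; exact: expR_ge0.
have mW : measurable_fun setT W.
  apply: measurable_sum => j; apply: measurable_funD; apply: measurableT_comp => //;
  apply: measurable_funM => //;
  by apply: measurable_sum => i; apply: measurable_funM; [exact: mxi|exact: mX].
have mf2 : measurable_fun setT f2.
  apply: measurable_sum => j; apply: measurableT_comp => //.
  apply: measurable_funM => //; apply: measurable_funB => //.
  by apply: measurable_sum => i; apply: measurable_funX; exact: mX.
have mf1 : measurable_fun setT f1.
  rewrite /f1; under eq_fun => x do rewrite -big_filter.
  by apply: measurable_sum => s; exact: measurable_expR_inner_sqr.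
pose A := 4 * r ^+ 2.
pose g := (lam / 4)^-1 * (4 * r ^+ 2 * (10 * L ^+ 2) / k%:R + 4 * r * (t^-1 * b / N%:R)).
pose h := (lam / 4)^-1 * (4 * r * (t^-1 / expR b / N%:R)).
have A0 : 0 <= A by rewrite mulr_ge0// sqr_ge0.
have lamV : 0 <= (lam / 4)^-1 by rewrite invr_ge0 divr_ge0// ltW.
have tV : 0 <= t^-1 by rewrite invr_ge0 ltW.
have NV : 0 <= N%:R^-1 :> R by rewrite invr_ge0 ltW.
have kV : 0 <= k%:R^-1 :> R by rewrite invr_ge0 ltW.
have eV : 0 <= (expR b)^-1 by rewrite invr_ge0 expR_ge0.
have r4 : 0 <= 4 * r by rewrite mulr_ge0// ltW.
have g0 : 0 <= g.
  rewrite /g; apply: mulr_ge0 => //; apply: addr_ge0.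
    by rewrite mulr_ge0// mulr_ge0// mulr_ge0// sqr_ge0.
  by rewrite mulr_ge0// mulr_ge0// mulr_ge0.
have h0 : 0 <= h by rewrite /h mulr_ge0// mulr_ge0// mulr_ge0// mulr_ge0.
have ptw w : l2norm (betahat w - beta) ^+ 2 <=
    A * f1 w + (A * f2 w + (g + h * W w)).
  apply: le_trans (lasso_error_fails_le N0 p0 k0 r0 L_gt0 lam0 t0 b0 betar (minb w)) _.
  rewrite -/(f1 w) -/(f2 w) -/(W w) le_eqVlt; apply/orP; left; apply/eqP.
  by rewrite /A /g /h; ring.
have mA1 : measurable_fun setT (fun w => A * f1 w) by exact: measurable_funM.
have mA2 : measurable_fun setT (fun w => A * f2 w) by exact: measurable_funM.
have mhW : measurable_fun setT (fun w => h * W w) by exact: measurable_funM.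
have mghW : measurable_fun setT (fun w => g + h * W w) by exact: measurable_funD.
have m23 : measurable_fun setT (fun w => A * f2 w + (g + h * W w)) by exact: measurable_funD.
have A10 w : 0 <= A * f1 w by exact: mulr_ge0.
have A20 w : 0 <= A * f2 w by exact: mulr_ge0.
have hW0 w : 0 <= h * W w by exact: mulr_ge0.
have ghW0 w : 0 <= g + h * W w by exact: addr_ge0.
have A230 w : 0 <= A * f2 w + (g + h * W w) by exact: addr_ge0.
apply: le_trans (ge0_le_integral_EFin P _ _ _ ptw) _.
- under eq_fun => w do rewrite l2norm_sqr.
  apply: measurable_sum => j; apply: measurable_funX.
  rewrite (_ : (fun _ => _) = (fun w => betahat w j 0 - beta j 0)).
    by apply: measurable_funB => //; exact: mb.
  by apply/funext => w; rewrite !mxE.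
- exact: measurable_funD.
- by move=> w; exact: sqr_ge0.
rewrite ge0_integralD_EFin// ge0_integralD_EFin// ge0_integralD_EFin//.
rewrite integral_cst_EFin !ge0_integralZl_EFin_fun//.
rewrite -EFinM in If1; rewrite -EFinM in If2.
have AE : (0 <= A%:E)%E by rewrite lee_fin.
have hE : (0 <= h%:E)%E by rewrite lee_fin.
apply: le_trans (leeD (lee_wpmul2l AE If1) (leeD (lee_wpmul2l AE If2)
  (leeD (lexx g%:E) (lee_wpmul2l hE IW)))) _.
rewrite -!EFinM -!EFinD lee_fin le_eqVlt; apply/orP; left; apply/eqP.
by rewrite /A /g /h; ring.
Qed.

(* The ratio of the sparsity level k to N / log (ep). *)
Definition lasso_sparsity (R : realType) (L lam : R) : R :=
  lam ^+ 2 / (512 * L ^+ 4) / 4.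

(** In order, with kap the sparsity ratio: the regime log(ep) > kap N, the sparse failures, the
    column failures, the noise, and Maurey's term. *)
Definition lasso_const (R : realType) (L lam : R) : R :=
  4 / lasso_sparsity L lam + 2 / lasso_sparsity L lam + 4 + 160 * L / lam
  + 320 * L ^+ 2 / (lam * lasso_sparsity L lam).

Lemma lasso_sparsity_gt0 (R : realType) (L lam : R) :
  0 < L -> 0 < lam -> 0 < lasso_sparsity L lam.
Proof. by move=> L0 lam0; rewrite !divr_gt0 ?mulr_gt0 ?ltr0n ?exprn_gt0. Qed.

(** This makes log(ep) <= kap N imply log(ep) <= N, as the column failures and the smallness of [t]
    require. *)
Lemma lasso_sparsity_le1 (R : realType) (L lam : R) :
  1 <= L -> 0 < lam -> lam <= L -> lasso_sparsity L lam <= 1.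
Proof.
move=> L1 lam0 lamL; have L0 : 0 < L by lra.
rewrite ler_pdivrMr ?ltr0n// ler_pdivrMr ?mulr_gt0 ?ltr0n ?exprn_gt0// mul1r.
have h1 : lam ^+ 2 <= L ^+ 2 by rewrite lerXn2r ?nnegrE ?(ltW lam0) ?(ltW L0).
have h2 : L ^+ 2 <= L ^+ 4 by exact: ler_weXn2l.
have : 0 <= L ^+ 4 by rewrite exprn_ge0// ltW.
lra.
Qed.

(** * Choice of the parameters and the resulting rate *)

Lemma expRN_le_inv (R : realType) (x : R) : 0 < x -> expR (- x) <= x^-1.
Proof.
move=> x0; rewrite expRN lef_pV2 ?posrE ?expR_gt0//.
by have := expR_ge1Dx x; lra.
Qed.

Lemma lasso_rate_le (R : realType) (N p k : nat) (r L lam a rho l t b kap : R) :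
  (0 < N)%N -> (0 < p)%N -> (0 < k)%N -> 0 < r -> 1 <= L -> 0 < lam -> lam <= L ->
  0 < a -> 0 < rho -> l = N%:R * rho ^+ 2 -> 1 <= l -> p%:R * 2 <= expR l ->
  kap = lasso_sparsity L lam ->
  l <= kap * N%:R -> k%:R * l <= kap * N%:R -> kap * N%:R <= k.+1%:R * l ->
  t = rho / (4 * a * L) -> b = 3 / 2 * l ->
  4 * r ^+ 2 *
      (((p * 2) ^ k.+1)%:R * expR (- (N%:R * (lam ^+ 2 / (512 * L ^+ 4))))
       + p%:R * expR (- (2 * N%:R)))
     + (lam / 4)^-1 * (4 * r ^+ 2 * (10 * L ^+ 2) / k%:R + 4 * r * (t^-1 * (b +
       (p%:R * (2 * expR (N%:R * (8 * t ^+ 2 * a ^+ 2 * L ^+ 2)))) / expR b)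
        / N%:R))
  <= lasso_const L lam * (a * r * rho + r ^+ 2 * rho ^+ 2).
Proof.
move=> N0 p0 k0 r0 L1 lam0 lamL a0 rho0 lE l1 pl kapE lN kl kl' tE bE.
have L0 : 0 < L by lra.
have kap0 : 0 < kap by rewrite kapE; exact: lasso_sparsity_gt0.
have kap1 : kap <= 1 by rewrite kapE; exact: lasso_sparsity_le1.
have NR : 0 < N%:R :> R by rewrite ltr0n.
have kR : 0 < k%:R :> R by rewrite ltr0n.
have k1 : 1 <= k%:R :> R by rewrite ler1n.
have rho2 : 0 < rho ^+ 2 by rewrite exprn_gt0.
have lN1 : l <= N%:R by apply: le_trans lN _; rewrite ler_piMl// ltW.
have V : N%:R^-1 <= rho ^+ 2.
  by rewrite -[leLHS]mul1r ler_pdivrMr// mulrC -lE.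
(* The exponent is 4 kap N, while (2p)^(k+1) <= exp((k+1) l) <= exp(2 k l) <= exp(2 kap N). The
   remaining exp(-2 kap N) is at most 1 / (2 kap N), and 1 / N <= rho^2 since l >= 1. *)
have F1 : ((p * 2) ^ k.+1)%:R * expR (- (N%:R * (lam ^+ 2 / (512 * L ^+ 4))))
    <= rho ^+ 2 / (2 * kap).
  have -> : lam ^+ 2 / (512 * L ^+ 4) = 4 * kap.
    by rewrite kapE /lasso_sparsity [RHS]mulrC divfK// pnatr_eq0.
  apply: (@le_trans _ _ (expR (k.+1%:R * l) * expR (- (N%:R * (4 * kap))))).
    rewrite ler_wpM2r ?expR_ge0// expRM_natl natrX natrM.
    by rewrite lerXn2r ?nnegrE ?expR_ge0.
  rewrite -expRD; apply: (@le_trans _ _ (expR (- (2 * kap * N%:R)))).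
    rewrite ler_expR -natr1.
    have : l <= k%:R * l by rewrite ler_peMl//; lra.
    by lra.
  apply: le_trans (expRN_le_inv _) _; first by rewrite mulr_gt0// mulr_gt0.
  by rewrite invfM mulrC ler_wpM2r// invr_ge0 mulr_ge0 ?ltW.
have F2 : p%:R * expR (- (2 * N%:R)) <= rho ^+ 2.
  apply: le_trans V; apply: le_trans (expRN_le_inv NR).
  rewrite -[in leRHS](_ : N%:R + - (2 * N%:R) = - N%:R :> R); last by ring.
  rewrite expRD ler_wpM2r ?expR_ge0//; apply: (@le_trans _ _ (expR l)).
    by have : 0 <= p%:R :> R by []; lra.
  by rewrite ler_expR.
have E8 : N%:R * (8 * t ^+ 2 * a ^+ 2 * L ^+ 2) = l / 2.
  by rewrite tE lE; field; rewrite !gt_eqF.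
(* The choice b = 3l/2 balances the mean of [W]: l for the 2p exponentials and l/2 for the exponent
   computed in [E8]. *)
have Q : p%:R * (2 * expR (N%:R * (8 * t ^+ 2 * a ^+ 2 * L ^+ 2))) / expR b <= 1.
  rewrite E8 ler_pdivrMr ?expR_gt0// mul1r mulrA.
  have -> : expR b = expR l * expR (l / 2) by rewrite -expRD bE; congr expR; lra.
  by rewrite ler_wpM2r ?expR_ge0.
have tV : 0 < t^-1 by rewrite invr_gt0 tE divr_gt0// !mulr_gt0.
have Fn : t^-1 * (b + p%:R * (2 * expR (N%:R * (8 * t ^+ 2 * a ^+ 2 * L ^+ 2))) / expR b)
    / N%:R <= 10 * a * L * rho.
  apply: (@le_trans _ _ (t^-1 * (5 / 2 * l) / N%:R)).
    rewrite ler_wpM2r ?invr_ge0 ?(ltW NR)// ler_wpM2l ?(ltW tV)//.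
    by move: Q l1 bE; clear; lra.
  rewrite le_eqVlt; apply/orP; left; apply/eqP.
  by rewrite lE tE; field; rewrite !gt_eqF.
(* Rounding down costs a factor 2: kap N <= (k+1) l <= 2 k l. *)
have Fk : k%:R^-1 <= 2 * rho ^+ 2 / kap.
  rewrite ler_pdivlMr// mulrC ler_pdivrMr//.
  rewrite -(ler_pM2l NR).
  have : k.+1%:R * l <= 2 * k%:R * l by rewrite ler_wpM2r//; rewrite -?natr1; lra.
  by rewrite lE in kl' *; lra.
have r2 : 0 <= 4 * r ^+ 2 by rewrite mulr_ge0// sqr_ge0.
have lamV : 0 <= (lam / 4)^-1 by rewrite invr_ge0 divr_ge0// ltW.
have c10 : 0 <= 4 * r ^+ 2 * (10 * L ^+ 2) by rewrite mulr_ge0// mulr_ge0// sqr_ge0.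
have r4 : 0 <= 4 * r by rewrite mulr_ge0// ltW.
have S1 := ler_wpM2l r2 (lerD F1 F2).
have S2 := ler_wpM2l lamV (lerD (ler_wpM2l c10 Fk) (ler_wpM2l r4 Fn)).
apply: le_trans (lerD S1 S2) _.
rewrite /lasso_const -kapE -subr_ge0; clear kapE.
rewrite (_ : _ - _ = 4 / kap * (a * r * rho + r ^+ 2 * rho ^+ 2)
   + (2 / kap + 4 + 320 * L ^+ 2 / (lam * kap)) * (a * r * rho)
   + 160 * L / lam * (r ^+ 2 * rho ^+ 2)); last first.
  by field; rewrite !gt_eqF.
have arr : 0 <= a * r * rho by rewrite !mulr_ge0// ltW.
have rr : 0 <= r ^+ 2 * rho ^+ 2 by rewrite mulr_ge0 ?sqr_ge0.
have LL : 0 <= L ^+ 2 by rewrite sqr_ge0.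
have LL0 := ltW L0.
have c1 : 0 <= 4 / kap := divr_ge0 (ler0n _ 4) (ltW kap0).
have c2 : 0 <= 2 / kap + 4 + 320 * L ^+ 2 / (lam * kap) :=
  addr_ge0 (addr_ge0 (divr_ge0 (ler0n _ 2) (ltW kap0)) (ler0n _ 4))
    (divr_ge0 (mulr_ge0 (ler0n _ 320) LL) (ltW (mulr_gt0 lam0 kap0))).
have c3 : 0 <= 160 * L / lam :=
  divr_ge0 (mulr_ge0 (ler0n _ 160) LL0) (ltW lam0).
exact: addr_ge0 (addr_ge0 (mulr_ge0 c1 (addr_ge0 arr rr)) (mulr_ge0 c2 arr))
  (mulr_ge0 c3 rr).
Qed.

(** The factor e inside the logarithm absorbs the two signs, as 2 <= e, and keeps the logarithm at
    least 1 even for p = 1. *)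
Lemma ln_expR1M (R : realType) (p : nat) : (0 < p)%N ->
  1 <= ln (expR 1 * p%:R) :> R /\ p%:R * 2 <= expR (ln (expR 1 * p%:R)) :> R.
Proof.
move=> p0; have pR : 0 < p%:R :> R by rewrite ltr0n.
have p1 : 1 <= p%:R :> R by rewrite ler1n.
split.
  by rewrite lnM ?posrE ?expR_gt0// expRK lerDl ln_ge0.
rewrite lnK ?posrE ?mulr_gt0 ?expR_gt0// mulrC ler_wpM2r ?(ltW pR)//.
by have := expR_ge1Dx (1 : R); lra.
Qed.

Lemma lasso_const_gt0 (R : realType) (L lam : R) :
  0 < L -> 0 < lam -> 0 < lasso_const L lam.
Proof.
move=> L0 lam0; have k0 := lasso_sparsity_gt0 L0 lam0.
rewrite /lasso_const; set k := lasso_sparsity L lam in k0 *.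
have h1 : 0 < 4 / k := divr_gt0 (ltr0Sn _ 3) k0.
have h2 : 0 < 2 / k := divr_gt0 (ltr0Sn _ 1) k0.
have h3 : 0 < 160 * L / lam := divr_gt0 (mulr_gt0 (ltr0Sn _ 159) L0) lam0.
have h4 : 0 < 320 * L ^+ 2 / (lam * k) :=
  divr_gt0 (mulr_gt0 (ltr0Sn _ 319) (exprn_gt0 2 L0)) (mulr_gt0 lam0 k0).
exact: addr_gt0 (addr_gt0 (addr_gt0 (addr_gt0 h1 h2) (ltr0Sn _ 3)) h3) h4.
Qed.

Lemma lasso_expected_rate d (T : measurableType d) (R : realType)
    (P : probability T R) (N p : nat) (r L0 L lam a : R)
    (X : T -> 'M[R]_(N, p)) (xi : T -> 'cV[R]_N) (beta : 'cV[R]_p)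
    (Sigma : 'M[R]_p) (betahat : T -> 'cV[R]_p) :
  (0 < N)%N -> (0 < p)%N -> 0 < r -> 1 <= L -> `|L0| <= L ->
  0 < lam -> lam <= L -> 0 < a -> l1norm beta <= r ->
  random_mx X -> random_mx xi -> random_mx betahat ->
  independent_rows P X ->
  (forall i, mean_zero_vec P (fun w => (row i (X w))^T)) ->
  (forall i, subgaussian_vec P L0 (fun w => (row i (X w))^T)) ->
  (forall i, covariance_mx P (fun w => (row i (X w))^T) Sigma) ->
  loewner_le lam%:M Sigma -> independent_rows P xi ->
  (forall i (s : R), (\int[P]_w (expR (s * xi w i 0))%:E
     <= (expR (4 * (s ^+ 2 * a ^+ 2)))%:E)%E) ->
  independent2 P (sigma_mx X) (sigma_mx xi) ->
  (forall w, lasso_argmin r (X w) (X w *m beta + xi w) (betahat w)) ->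
  (\int[P]_w (l2norm (betahat w - beta) ^+ 2)%:E <=
    (lasso_const L lam * (a * r * Num.sqrt (ln (expR 1 * p%:R) / N%:R)
       + r ^+ 2 * (ln (expR 1 * p%:R) / N%:R)))%:E)%E.
Proof.
move=> N0 p0 r0 L1 LL lam0 lamL a0 betar mX mxi mb indX EX sgX covX loew
  indxi sgxi ind minb.
have L_gt0 : 0 < L by apply: lt_le_trans L1.
have NR : 0 < N%:R :> R by rewrite ltr0n.
have [l1 pl] := ln_expR1M R p0.
set l := ln _ in l1 pl *.
have l0 : 0 < l by apply: lt_le_trans l1.
have lNR : 0 < l / N%:R by rewrite divr_gt0.
pose rho := Num.sqrt (l / N%:R).
have rho0 : 0 < rho by rewrite sqrtr_gt0.
have rho2 : l / N%:R = rho ^+ 2 by rewrite sqr_sqrtr// ltW.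
have lE : l = N%:R * rho ^+ 2 by rewrite -rho2 mulrC divfK// gt_eqF.
rewrite -/rho rho2.
have kap0 := lasso_sparsity_gt0 L_gt0 lam0.
have kap1 := lasso_sparsity_le1 L1 lam0 lamL.
have [kap kapE] : exists kap, kap = lasso_sparsity L lam by eexists.
rewrite -kapE in kap0 kap1.
have arr : 0 <= a * r * rho by rewrite !mulr_ge0// ltW.
(* In the first case kap N / l >= 1, so its integer part is an admissible [k]. In the second, rho^2
   > kap and the diameter bound 4 r^2 is at most (4 / kap) r^2 rho^2. *)
have [lN|Nl] := leP l (kap * N%:R).
  pose k := Num.truncn (kap * N%:R / l).
  have x1 : 1 <= kap * N%:R / l by rewrite ler_pdivlMr// mul1r.
  have x0 : 0 <= kap * N%:R / l by apply: le_trans x1.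
  have k0 : (0 < k)%N by rewrite truncn_gt0.
  have /andP[k1 k2] := truncn_itv x0.
  rewrite -/k ler_pdivlMr// in k1; rewrite -/k ltr_pdivrMr// in k2.
  pose t := rho / (4 * a * L); pose b := 3 / 2 * l.
  have t0 : 0 < t by rewrite divr_gt0// mulr_gt0// mulr_gt0.
  have b0 : 0 <= b by rewrite mulr_ge0// ltW.
  have rho1 : rho ^+ 2 <= 1.
    by rewrite -rho2 ler_pdivrMr// mul1r (le_trans lN)// ler_piMl// ltW.
  have taL : 4 * t ^+ 2 * a ^+ 2 * L ^+ 2 <= 1 / 4.
    rewrite (_ : _ * _ = rho ^+ 2 / 4).
      by rewrite ler_pM2r.
    by rewrite /t; field; rewrite !gt_eqF.
  apply: le_trans (lasso_expected_error_le N0 p0 k0 r0 L_gt0 LL lam0 t0 a0 b0 taL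
    betar mX mxi mb indX EX sgX covX loew indxi sgxi ind minb) _.
  rewrite lee_fin.
  exact: (lasso_rate_le N0 p0 k0 r0 L1 lam0 lamL a0 rho0 lE l1 pl kapE lN k1 (ltW k2)).
apply: (@le_trans _ _ (\int[P]_w (4 * r ^+ 2)%:E)%E).
  apply: ge0_le_integral_EFin => //.
  - under eq_fun => w do rewrite l2norm_sqr.
    apply: measurable_sum => j; apply: measurable_funX.
    rewrite (_ : (fun _ => _) = (fun w => betahat w j 0 - beta j 0)).
      by apply: measurable_funB => //; exact: mb.
    by apply/funext => w; rewrite !mxE.
  - by move=> w; exact: sqr_ge0.
  - move=> w; have [br _] := minb w.
    by have := l2norm_sqr_le_l1_bound (l1_ball_diameter br betar); lra.
rewrite integral_cst_EFin lee_fin.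
have kr : kap <= rho ^+ 2 by rewrite -rho2 ler_pdivlMr// ltW.
have C4 : 4 / kap <= lasso_const L lam.
  rewrite /lasso_const -kapE.
  have h2 : 0 <= 2 / kap := divr_ge0 (ler0n _ 2) (ltW kap0).
  have h3 : 0 <= 160 * L / lam :=
    divr_ge0 (mulr_ge0 (ler0n _ 160) (ltW L_gt0)) (ltW lam0).
  have h4 : 0 <= 320 * L ^+ 2 / (lam * kap) :=
    divr_ge0 (mulr_ge0 (ler0n _ 320) (sqr_ge0 L)) (ltW (mulr_gt0 lam0 kap0)).
  by move: h2 h3 h4; clear; lra.
have C0 := ltW (lasso_const_gt0 L_gt0 lam0).
apply: (@le_trans _ _ (4 / kap * (r ^+ 2 * rho ^+ 2))).
  rewrite [leRHS](_ : _ = 4 * r ^+ 2 * (rho ^+ 2 / kap)); last first.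
    by field; rewrite gt_eqF.
  apply: ler_peMr; first exact: mulr_ge0 (ler0n _ 4) (sqr_ge0 r).
  by rewrite ler_pdivlMr// mul1r.
have rr : 0 <= r ^+ 2 * rho ^+ 2 by rewrite mulr_ge0 ?sqr_ge0.
apply: le_trans (ler_wpM2r rr C4) _.
by rewrite ler_wpM2l// lerDr.
Qed.

Theorem mainTheorem3 (R : realType) (L lambda_m lambda_p : R)
  (lambda_m_gt0 : 0 < lambda_m) (lambda_mp : lambda_m <= lambda_p) :
  exists C : R, 0 < C /\
    forall (N p : nat) (r sigma : R) (beta : 'cV[R]_p) (Sigma : 'M[R]_p)
      (d : measure_display) (T : measurableType d) (P : probability T R)
      (X : T -> 'M[R]_(N, p)) (xi Y : T -> 'cV[R]_N) (betahat : T -> 'cV[R]_p),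
    (0 < N)%N -> (0 < p)%N -> 0 < r ->
    l1norm beta <= r ->
    random_mx X -> random_mx xi -> random_mx betahat ->
    (forall w, Y w = X w *m beta + xi w) ->
    independent_rows P X ->
    (forall i, mean_zero_vec P (fun w => (row i (X w))^T)) ->
    (forall i, subgaussian_vec P L (fun w => (row i (X w))^T)) ->
    (forall i, covariance_mx P (fun w => (row i (X w))^T) Sigma) ->
    loewner_le lambda_m%:M Sigma -> loewner_le Sigma lambda_p%:M ->
    independent_rows P xi ->
    (forall i, mean_zero P (fun w => xi w i 0)) ->
    (forall i, (psi2_norm P (fun w => xi w i 0%R) <= sigma%:E)%E) ->
    independent2 P (sigma_mx X) (sigma_mx xi) ->
    (forall w, lasso_argmin r (X w) (Y w) (betahat w)) ->
    ('E_P[fun w => (l2norm (betahat w - beta) ^+ 2)%R]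
      <= (C * (sigma * r * Num.sqrt (ln (expR 1 * p%:R) / N%:R)
               + r ^+ 2 * (ln (expR 1 * p%:R) / N%:R)))%:E)%E.
Proof.
(* A larger sub-Gaussian constant is harmless; being at least 1 and at least [lambda_m] yields a
   sparsity ratio at most 1. *)
pose L1 := Num.max (Num.max 1 `|L|) lambda_m.
have L1_1 : 1 <= L1 by rewrite !le_max lexx.
have LL1 : `|L| <= L1 by rewrite !le_max lexx orbT.
have lamL1 : lambda_m <= L1 by rewrite !le_max lexx orbT.
have L1_gt0 : 0 < L1 by apply: lt_le_trans L1_1.
have C0 := lasso_const_gt0 L1_gt0 lambda_m_gt0.
exists (lasso_const L1 lambda_m); split => //.
move=> N p r sigma beta Sigma d T P X xi Y betahat N0 p0 r0 betar mX mxi mb YE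
  indX EX sgX covX loew _ indxi Exi psixi ind minb.
have minb' w : lasso_argmin r (X w) (X w *m beta + xi w) (betahat w).
  by rewrite -YE.
rewrite unlock.
set C := lasso_const L1 lambda_m in C0 *.
set l := ln _; set rho := Num.sqrt _.
have [l1 _] := ln_expR1M R p0.
have rho0 : 0 < rho.
  by rewrite sqrtr_gt0 divr_gt0 ?ltr0n//; apply: lt_le_trans l1.
apply/lee_addgt0Pr => e e0.
(* An admissible scale strictly above [sigma], positive even if [sigma] is 0, with the excess set so
   that the final bound grows by exactly [e]. *)
pose a := sigma + e / (C * r * rho).
have Crr : 0 < C * r * rho := mulr_gt0 (mulr_gt0 C0 r0) rho0.
have sa : sigma < a by rewrite ltrDl divr_gt0.
have a0 : 0 < a by have [] := psi2_norm_lt (mxi (Ordinal N0) 0) (psixi _) sa.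
have sgxi i (s : R) : (\int[P]_w (expR (s * xi w i 0))%:E
     <= (expR (4 * (s ^+ 2 * a ^+ 2)))%:E)%E.
  have [_ psi] := psi2_norm_lt (mxi i 0) (psixi i) sa.
  exact: psi2_mgf (mxi i 0) (Exi i) a0 psi.
apply: le_trans (lasso_expected_rate N0 p0 r0 L1_1 LL1 lambda_m_gt0 lamL1 a0 betar
  mX mxi mb indX EX sgX covX loew indxi sgxi ind minb') _.
have aE : a * (C * r * rho) = sigma * (C * r * rho) + e.
  by rewrite /a mulrDl divfK// gt_eqF.
rewrite -EFinD lee_fin -/l -/rho -/C le_eqVlt; apply/orP; left; apply/eqP.
by move: aE; clearbody a C rho; clear; lra.
Qed.
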